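(* Let $H,f$ satisfy the structural assumptions of the context. Let $\mu_i=m_i\mathcal L^d\in\mathcal P^r_{2,p}(\mathbb R^d)$, $i=0,1$, and $(m,v)\in CE_{2,p}(Q;\mu_0,\mu_1)$. The pair $(m,v)$ minimizes $\mathcal B$ over $CE_{2,p}(Q;\mu_0,\mu_1)$ if and only if, setting $\alpha:=f(x,m)$, the pair $(m,v)$ minimizes the modified Lagrangian dynamic cost $$\mathcal L_\alpha(m',v'):=\int_Q\Big(L(x,v')+\alpha(t,x)\Big)m'\,dx\,dt$$ among all pairs $(m',v')\in CE_{2,p}(Q;\mu_0,\mu_1)$, i.e. $\mathcal L_\alpha(m,v)\le\mathcal L_\alpha(m',v')$ for every $(m',v')\in CE_{2,p}(Q;\mu_0,\mu_1)$.
   Context: Notation. $d\ge1$, $Q=(0,1)\times\mathbb R^d$, $\lambda$ is Lebesgue measure on $Q$, $p,q\in(1,\infty)$ with $1/p+1/q=1$, $\kappa(x)=1+|x|^2$. ''Increasing'' means nondecreasing. $\mathcal P_2(\mathbb R^d)$: Borel probability measures with finite second moment, with the Wasserstein distance $W_2$. $\mathcal P^r_{2,p}(\mathbb R^d)$: the $\mu=m\mathcal L^d\in\mathcal P_2(\mathbb R^d)$ with $m\in L^p(\mathbb R^d)$. $L^1_\kappa$: functions $g$ with $\kappa g\in L^1$. $AC^2([0,1];Y)$: absolutely continuous curves with metric velocity in $L^2(0,1)$. Structural assumptions. $f:\mathbb R^d\times[0,\infty)\to\mathbb R$ is Carathéodory (measurable in $x$, continuous in $m$), increasing in $m$, and for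 some $c_f\ge1$ and nonnegative $\gamma_f\in L^q(\mathbb R^d)$: $c_f^{-p}m^{p-1}-\gamma_f(x)\le f(x,m)\le c_f^p m^{p-1}+\gamma_f(x)$ for all $m\ge0$, a.e. $x$. $F(x,m)=\int_0^mf(x,\tau)\,d\tau$ for $m\ge0$. $H:\mathbb R^d\times\mathbb R^d\to\mathbb R$, $(x,\xi)\mapsto H(x,\xi)$, is Carathéodory, convex and differentiable in $\xi$, and there are $c_H\ge1$, $c_H^\pm>0$ with $\frac1{2c_H}|\xi|^2-c_H^-(1+|x|^2)\le H(x,\xi)\le\frac{c_H}2|\xi|^2+c_H^+(1+|x|)$ for all $\xi$, a.e. $x$. $L(x,v):=\sup_\xi[-v\cdot\xi-H(x,\xi)]$. $CE_{2,p}(Q;\mu_0,\mu_1)$: pairs $(m,v)$ with $m\in L^1_\kappa(Q)\cap L^p(Q)$ a probability density on $Q$, $v\in L^2(Q,m\lambda;\mathbb R^d)$, $\partial_tm+\nabla\cdot(mv)=0$ in $\mathscr D'(Q)$, whose continuous representative $\mu\in AC^2([0,1];\mathcal P_2(\mathbb R^d))$ (the unique such curve with $m\lambda=\int_0^1\delta_t\otimes\mu_t\,dt$) satisfies $\mu_{t=0}=\mu_0$, $\mu_{t=1}=\mu_1$. $\mathcal B(m,v)=\int_Q\big(L(x,v)m+F(x,m)\big)\,dx\,dt$. *)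

(* Defs.v *)
From HB Require Import structures.
From mathcomp Require Import all_boot all_order all_algebra.
From mathcomp Require Import all_classical all_reals all_analysis.

Set Implicit Arguments.
Unset Strict Implicit.
Unset Printing Implicit Defensive.

Import Order.TTheory GRing.Theory Num.Theory.
Import numFieldNormedType.Exports.

Local Open Scope classical_set_scope.
Local Open Scope ring_scope.

(* The sigma-algebra generated by the coordinates, as the library does for
   tuples; [measurable_rVE] shows that it is the Borel sigma-algebra.          *)
Definition rV_display : measure_display.
Proof. exact. Qed.

Section measurable_rV.
Context {R : realType} {n : nat}.

Definition rV_coord (i : 'I_n) (x : 'rV[R]_n) : R := x ord0 i.

Let rV_set0 : g_sigma_preimage rV_coord set0.
Proof. exact: sigma_algebra0. Qed.

Let rV_setC A : g_sigma_preimage rV_coord A -> g_sigma_preimage rV_coord (~` A).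
Proof. exact: sigma_algebraC. Qed.

Let rV_bigcup (F : (set 'rV[R]_n)^nat) :
  (forall i, g_sigma_preimage rV_coord (F i)) ->
  g_sigma_preimage rV_coord (\bigcup_i (F i)).
Proof. exact: sigma_algebra_bigcup. Qed.

HB.instance Definition _ := @isMeasurable.Build rV_display
  'rV[R]_n (g_sigma_preimage rV_coord) rV_set0 rV_setC rV_bigcup.

Lemma measurable_rV_coord (i : 'I_n) :
  measurable_fun [set: 'rV[R]_n] (fun x : 'rV[R]_n => x ord0 i).
Proof.
move=> _ Y mY; rewrite setTI; apply: sub_sigma_algebra => /=.
rewrite -bigcup_seq/=; exists i => /=; first by rewrite mem_index_enum.
by exists Y => //; rewrite setTI.
Qed.

Lemma measurable_fun_rVP d (T : measurableType d) (f : T -> 'rV[R]_n) :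
  measurable_fun [set: T] f <->
  forall i, measurable_fun [set: T] (fun x => f x ord0 i).
Proof.
split=> [mf i|mf].
  exact: (measurableT_comp (measurable_rV_coord i) mf).
have mimg : \big[setU/set0]_(i < n)
    preimage_set_system setT (rV_coord i) measurable `<=`
    [set B | measurable (f @^-1` B)].
  move=> A; rewrite -bigcup_seq => -[i _ [B mB <-]] /=.
  by rewrite setTI; have := mf i measurableT B mB; rewrite setTI.
move=> _ B mB; rewrite setTI; move: B mB.
apply: smallest_sub mimg; split=> /=.
- by rewrite preimage_set0.
- move=> A mA; rewrite setTD preimage_setC; exact: measurableC.
- by move=> F mF; rewrite preimage_bigcup; exact: bigcup_measurable.
Qed.

Let measurable_rV_ball (c : 'rV[R]_n) (e : R) :
  0 < e -> measurable (ball c e).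
Proof.
move=> e0; have -> : ball c e = \bigcap_(i in [set: 'I_n])
    ((fun x : 'rV[R]_n => x ord0 i) @^-1` ball (c ord0 i) e).
  apply/seteqP; split=> [x [_ cx] i _|x cx]; first exact: cx.
  by split=> // i j; rewrite ord1; exact: cx.
apply: fin_bigcap_measurable => // i _.
rewrite -[X in measurable X]setTI; apply: measurable_rV_coord => //.
by rewrite ball_itv; exact: measurable_itv.
Qed.

Let open_measurable_rV (U : set 'rV[R]_n) : open U -> measurable U.
Proof.
move=> oU.
pose bl (z : 'rV[rat]_n * nat) : set 'rV[R]_n :=
  ball (map_mx ratr z.1 : 'rV[R]_n) (z.2.+1%:R^-1 : R).
have -> : U = \bigcup_(z in [set z | bl z `<=` U]) bl z.
  apply/seteqP; split=> [x Ux|x [z zU]]; last exact: zU.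
  have /nbhs_ballP[e e0 eU] : nbhs x U by exact: open_nbhs_nbhs.
  pose k := Num.truncn ((2 / e) : R).
  have k0 : 0 < k.+1%:R^-1 :> R by rewrite invr_gt0.
  have ke : k.+1%:R^-1 * 2 < e :> R.
    by rewrite mulrC ltr_pdivrMr// mulrC -ltr_pdivrMr// truncnS_gt.
  have /choice[q xq] i : exists q : rat, `|x ord0 i - ratr q| < k.+1%:R^-1.
    have [|q] := @rat_in_itvoo _ (x ord0 i - k.+1%:R^-1) (x ord0 i + k.+1%:R^-1).
      by rewrite ltrD2l gtrN.
    rewrite in_itv/= => /andP[q1 q2]; exists q.
    by rewrite ltr_distlC q1.
  pose c : 'rV[R]_n := map_mx ratr (\row_i q i).
  have qx : ball c k.+1%:R^-1 x.
    split=> // i j; rewrite !mxE ord1; rewrite -ball_normE/= distrC.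
    exact: (xq j).
  exists (\row_i q i, k) => //= y qy; apply: eU.
  apply: (@le_ball _ _ _ (k.+1%:R^-1 * 2)); first exact: ltW.
  rewrite mulr_natr mulr2n; exact: (@ball_triangle _ _ c _ _ _ _ (ball_sym qx) qy).
rewrite bigcup_mkcond; apply: countable_bigcupT_measurable => // z.
by case: ifP => // _; apply: measurable_rV_ball; rewrite invr_gt0.
Qed.

Lemma measurable_rVE :
  (measurable : set (set 'rV[R]_n)) = <<s [set A : set 'rV[R]_n | open A] >>.
Proof.
apply/seteqP; split; last first.
  apply: smallest_sub; last by move=> A; exact: open_measurable_rV.
  split=> [|A mA|F mF]; [exact: measurable0| |exact: bigcupT_measurable].
  by rewrite setTD; exact: measurableC.
apply: smallest_sub; first exact: smallest_sigma_algebra.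
move=> A; rewrite -bigcup_seq => -[i _ [B mB <-]]; rewrite setTI.
have : (@ocitv R).-sigma.-measurable B by [].
rewrite measurable_realfun.RGenOpens.measurableE; move: B {mB}.
pose S := <<s [set A : set 'rV[R]_n | open A] >>.
suff : <<s @measurable_realfun.RGenOpens.G R >> `<=` [set B | S (rV_coord i @^-1` B)] by [].
apply: smallest_sub.
  split=> [|B SB|F SF] /=.
  - by rewrite preimage_set0; exact: sigma_algebra0.
  - by rewrite setTD preimage_setC -setTD; exact: sigma_algebraCD.
  - by rewrite preimage_bigcup; exact: sigma_algebra_bigcup.
move=> _ [x [y ->]]; apply: sub_sigma_algebra => /=.
by apply: open_comp => [z _|]; [exact: coord_continuous|exact: interval_open].
Qed.

End measurable_rV.

Section lebesgue_rV.
Context {R : realType}.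

Definition cons_rV n (z : R * 'rV[R]_n) : 'rV[R]_n.+1 :=
  row_mx (z.1%:M : 'rV[R]_1) z.2.

Lemma measurable_cons_rV n :
  measurable_fun [set: R * 'rV[R]_n] (@cons_rV n).
Proof.
apply/measurable_fun_rVP => i.
have [j ->|j ->] := @split_ordP 1 n i.
  rewrite (_ : (fun _ => _) = fst)//; apply/funext => z.
  by rewrite [LHS](@row_mxEl _ 1 1 n) mxE !ord1 eqxx mulr1n.
rewrite (_ : (fun _ => _) = (fun x : 'rV[R]_n => x ord0 j) \o snd); last first.
  by apply/funext => z; rewrite [LHS](@row_mxEr _ 1 1 n).
exact: measurableT_comp (measurable_rV_coord j) measurable_snd.
Qed.

Section next.
Variables (n : nat) (mu : {sigma_finite_measure set 'rV[R]_n -> \bar R}).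

Definition lebesgue_cons : set 'rV[R]_n.+1 -> \bar R :=
  pushforward (lebesgue_measure \x mu)%E (@cons_rV n).

HB.instance Definition _ := Measure.copy lebesgue_cons
  (measure_function_pushforward__canonical__measure_function_Measure
    (lebesgue_measure \x mu)%E (@measurable_cons_rV n)).

Let sigma_finite_lebesgue_cons : sigma_finite setT lebesgue_cons.
Proof.
have /sigma_finiteP[F [TF ndF Foo]] := sigma_finiteT (@lebesgue_measure R).
have /sigma_finiteP[G [TG ndG Goo]] := sigma_finiteT mu.
pose g (x : 'rV[R]_n.+1) : R * 'rV[R]_n := (x ord0 ord0, \row_i x ord0 (lift ord0 i)).
have mg : measurable_fun setT g.
  apply/measurable_fun_pairP; split; first exact: measurable_rV_coord.
  apply/measurable_fun_rVP => i.
  rewrite (_ : (fun _ => _) = fun x : 'rV[R]_n.+1 => x ord0 (lift ord0 i)).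
    exact: measurable_rV_coord.
  by apply/funext => x; rewrite mxE.
have gK : cancel (@cons_rV n) g.
  move=> [a x]; congr pair.
    have -> : ord0 = lshift n (ord0 : 'I_1) :> 'I_(1 + n) by exact: val_inj.
    by rewrite [LHS](@row_mxEl _ 1 1 n) mxE eqxx mulr1n.
  apply/rowP => i; rewrite mxE.
  have -> : lift ord0 i = rshift 1 i :> 'I_(1 + n) by exact: val_inj.
  by rewrite [LHS](@row_mxEr _ 1 1 n).
exists (fun k => g @^-1` (F k `*` G k)).
  rewrite -preimage_bigcup -[LHS](preimage_setT g); congr (_ @^-1` _).
  apply/seteqP; split=> // -[x y] _.
  have [i _ Fx] : (\bigcup_k F k) x by rewrite -TF.
  have [j _ Gy] : (\bigcup_k G k) y by rewrite -TG.
  exists (maxn i j) => //; split.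
  - by move: x Fx; exact/subsetPset/ndF/leq_maxl.
  - by move: y Gy; exact/subsetPset/ndG/leq_maxr.
move=> k; have [mF Fk] := Foo k; have [mG Gk] := Goo k; split.
  by rewrite -[X in measurable X]setTI; apply: mg => //; exact: measurableX.
rewrite /lebesgue_cons /pushforward -comp_preimage.
rewrite (_ : g \o _ = id); last by apply/funext => z /=; rewrite gK.
by rewrite preimage_id product_measure1E// lte_mul_pinfty// ge0_fin_numE.
Qed.

HB.instance Definition _ := Measure_isSigmaFinite.Build _ _ _ lebesgue_cons
  sigma_finite_lebesgue_cons.
End next.

Fixpoint lebesgue_rV n : {sigma_finite_measure set 'rV[R]_n -> \bar R} :=
  if n is n'.+1 then lebesgue_cons (lebesgue_rV n') else \d_(0 : 'rV[R]_0).

End lebesgue_rV.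

Section problem.
Context {R : realType} {d : nat}.
Implicit Types (x xi : 'rV[R]_d) (z : R * 'rV[R]_d).

(* The library norm of ['rV[R]_d] is the sup norm, hence this one. *)
Definition dotp (x y : 'rV[R]_d) : R := \sum_(i < d) x ord0 i * y ord0 i.
Definition enorm (x : 'rV[R]_d) : R := Num.sqrt (dotp x x).
Definition kappa (x : 'rV[R]_d) : R := 1 + enorm x ^+ 2.

Definition Q : set (R * 'rV[R]_d) := `]0, 1[ `*` setT.
Definition lebesgue_tx : set (measurableTypeR R * 'rV[R]_d)%type -> \bar R :=
  (lebesgue_measure \x lebesgue_rV d)%E.
HB.instance Definition _ := Measure.on lebesgue_tx.

(* L^r functions on a subdomain; the library's [Lfun] is about total functions. *)
Definition Lp_on dT (T : measurableType dT) (mu : {measure set T -> \bar R})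
    (D : set T) (r : R) (g : T -> R) : Prop :=
  measurable_fun D g /\ (\int[mu]_(x in D) (`|g x| `^ r)%:E < +oo)%E.

Record f_assumptions (p q : R) (f : 'rV[R]_d -> R -> R) : Prop := {
  f_measurable : forall s, 0 <= s -> measurable_fun setT (fun x => f x s) ;
  f_continuous : forall x, {within `[0, +oo[, continuous (f x)} ;
  f_increasing : forall x s t, 0 <= s -> s <= t -> f x s <= f x t ;
  f_growth : exists (c : R) (gamma : 'rV[R]_d -> R),
    [/\ 1 <= c, forall x, 0 <= gamma x, gamma \in Lfun (lebesgue_rV d) q%:E &
      {ae lebesgue_rV d, forall x, forall s, 0 <= s ->
         c `^ (- p) * s `^ (p - 1) - gamma x <= f x s
           <= c `^ p * s `^ (p - 1) + gamma x}] }.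

Record H_assumptions (H : 'rV[R]_d -> 'rV[R]_d -> R) : Prop := {
  H_measurable : forall xi, measurable_fun setT (fun x => H x xi) ;
  H_continuous : forall x, continuous (H x) ;
  H_convex : forall x, convex_function setT (H x) ;
  H_differentiable : forall x xi, differentiable (H x) xi ;
  H_growth : exists c cminus cplus : R,
    [/\ 1 <= c, 0 < cminus, 0 < cplus &
      {ae lebesgue_rV d, forall x, forall xi,
         (2 * c)^-1 * enorm xi ^+ 2 - cminus * (1 + enorm x ^+ 2) <= H x xi
           <= c / 2 * enorm xi ^+ 2 + cplus * (1 + enorm x)}] }.

Definition Fprim (f : 'rV[R]_d -> R -> R) x (s : R) : R :=
  \int[lebesgue_measure]_(tau in `[0, s]) f x tau.

Definition Lagr (H : 'rV[R]_d -> 'rV[R]_d -> R) x (v : 'rV[R]_d) : \bar R :=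
  ereal_sup [set (- dotp v xi - H x xi)%:E | xi in [set: 'rV[R]_d]].

Definition P2 (mu : probability 'rV[R]_d R) : Prop :=
  (\int[mu]_x (enorm x ^+ 2)%:E < +oo)%E.

Definition P2r (p : R) (mu : probability 'rV[R]_d R) : Prop :=
  P2 mu /\ exists m : 'rV[R]_d -> R,
    [/\ forall x, 0 <= m x, m \in Lfun (lebesgue_rV d) p%:E &
      forall A, measurable A -> mu A = (\int[lebesgue_rV d]_(x in A) (m x)%:E)%E].

Definition coupling (mu nu : probability 'rV[R]_d R)
    (g : probability ('rV[R]_d * 'rV[R]_d)%type R) : Prop :=
  forall A, measurable A -> g (A `*` setT) = mu A /\ g (setT `*` A) = nu A.

Definition W2 (mu nu : probability 'rV[R]_d R) : \bar R :=
  (ereal_inf [set \int[g]_y (enorm (y.1 - y.2) ^+ 2)%:E | g in coupling mu nu]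
     `^ 2^-1)%E.

(* Upper metric derivative; when [mu] is absolutely continuous, it is a limit
   for a.e. [t].                                                              *)
Definition metric_velocity (mu : R -> probability 'rV[R]_d R) (t : R) : \bar R :=
  lime_sup (fun s => W2 (mu s) (mu t) * (`|s - t|^-1)%:E)%E t.

(* [AC^2([0,1]; P_2)]: only the restriction of [mu] to [[0,1]] matters. Since
   the metric velocity of an absolutely continuous curve is nonnegative and
   measurable, it is in L^2 as soon as an L^2 function dominates it.          *)
Definition AC2 (mu : R -> probability 'rV[R]_d R) : Prop :=
  [/\ forall t, 0 <= t <= 1 -> P2 (mu t),
      exists2 g : R -> R, Lp_on lebesgue_measure `]0, 1[ 1 g &
        forall s t, 0 <= s -> s <= t -> t <= 1 ->
          (W2 (mu s) (mu t) <= \int[lebesgue_measure]_(r in `]s, t[) (g r)%:E)%E &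
      exists2 w : R -> R, Lp_on lebesgue_measure `]0, 1[ 2 w &
        {ae lebesgue_measure, forall t, 0 < t < 1 ->
          (metric_velocity mu t <= (w t)%:E)%E}].

Fixpoint Ck (k : nat) (phi : R * 'rV[R]_d -> R) : Prop :=
  if k is k'.+1 then
    (forall z, differentiable phi z) /\ (forall u, Ck k' ('D_u phi))
  else continuous phi.

Definition test_function (phi : R * 'rV[R]_d -> R) : Prop :=
  (forall k, Ck k phi) /\
  exists K : set (R * 'rV[R]_d),
    [/\ compact K, K `<=` Q & forall z, ~ K z -> phi z = 0].

Definition continuity_equation (m : R * 'rV[R]_d -> R)
    (v : R * 'rV[R]_d -> 'rV[R]_d) : Prop :=
  forall phi, test_function phi ->
    (\int[lebesgue_tx]_(z in Q)
       (m z * ('D_(1, 0) phi z +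
               \sum_(i < d) v z ord0 i * 'D_(0, delta_mx ord0 i) phi z))%:E = 0)%E.

(* [m] and [v] are representatives of their classes, [m] being chosen
   nonnegative everywhere on [Q] since [f x] only makes sense on [0, +oo[.    *)
Definition CE2 (p : R) (mu0 mu1 : probability 'rV[R]_d R)
    (m : R * 'rV[R]_d -> R) (v : R * 'rV[R]_d -> 'rV[R]_d) : Prop :=
  [/\ [/\ forall z, Q z -> 0 <= m z,
          (\int[lebesgue_tx]_(z in Q) (m z)%:E = 1)%E,
          lebesgue_tx.-integrable Q (fun z => (kappa z.2 * m z)%:E) &
          Lp_on lebesgue_tx Q p m],
      measurable_fun Q v /\
        (\int[lebesgue_tx]_(z in Q) (enorm (v z) ^+ 2 * m z)%:E < +oo)%E,
      continuity_equation m v &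
      exists mu : R -> probability 'rV[R]_d R,
        [/\ AC2 mu,
            forall A : set (R * 'rV[R]_d), measurable A ->
              (\int[lebesgue_tx]_(z in Q `&` A) (m z)%:E =
               \int[lebesgue_measure]_(t in `]0%R, 1%R[) mu t (xsection A t))%E,
            forall A, measurable A -> mu 0 A = mu0 A &
            forall A, measurable A -> mu 1 A = mu1 A]].

Definition Bcost (H : 'rV[R]_d -> 'rV[R]_d -> R) (f : 'rV[R]_d -> R -> R)
    (m : R * 'rV[R]_d -> R) (v : R * 'rV[R]_d -> 'rV[R]_d) : \bar R :=
  (\int[lebesgue_tx]_(z in Q)
     (Lagr H z.2 (v z) * (m z)%:E + (Fprim f z.2 (m z))%:E))%E.

Definition Lcost (H : 'rV[R]_d -> 'rV[R]_d -> R) (alpha : R * 'rV[R]_d -> R)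
    (m : R * 'rV[R]_d -> R) (v : R * 'rV[R]_d -> 'rV[R]_d) : \bar R :=
  (\int[lebesgue_tx]_(z in Q)
     ((Lagr H z.2 (v z) + (alpha z)%:E) * (m z)%:E))%E.

End problem.

(* Main.v *)
From HB Require Import structures.
Require Import Defs.
From mathcomp Require Import all_boot all_order all_algebra.
From mathcomp Require Import all_classical all_reals all_analysis.
From mathcomp Require Import measurable_realfun lra ring.

Import Order.TTheory GRing.Theory Num.Theory.
Import numFieldNormedType.Exports.

Local Open Scope classical_set_scope.
Local Open Scope ring_scope.

(** The cost [Bcost] is convex in the pair formed by the density [m] and the flux
    [m *: v], and [Lcost] with [alpha = f x m] is its linearisation in the congestion
    part. Write [K m v] for the kinetic energy (the integral of [L(x,v) m]), [G m] for
    the potential (the integral of [F(x,m)]) and [A u m] for the integral of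
    [f(x,u) m]. Then [Bcost m v = K m v + G m], and the modified cost of [(m', v')] is
    [K m' v' + A m m']. As [f x] is nondecreasing, [F x] is convex and lies above its
    tangents, so that [G m + A m m' <= G m' + A m m] for all competitors
    ([potential_tangent]).

    If [(m, v)] minimises the modified cost, this inequality gives at once that it
    minimises [Bcost] ([Lmin_Bmin]). Conversely, compare [(m, v)] with the pair
    [(m_s, v_s)] whose density is [(1 - s) m + s m'] and whose flux is the same
    combination of the two fluxes. The kinetic energy is jointly convex in density and
    flux, being a supremum of linear functions of them ([kinetic_interp]), and the
    increment of [G] is bounded through its tangent at [m_s]. Division by [s] leaves
    [K m v - K m' v' <= A m_s m' - A m_s m] ([first_variation]), and [s] tends to [0]
    by dominated convergence ([congestion_cvg]).

    Three facts support this. All integrals are finite: the growth of [f] and Young's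
    inequality bound [G] and [A] by [p]-th powers of the densities
    ([integrable_congestion]), and the quadratic growth of [H] bounds the Lagrangian
    by [|v|^2 + 1 + |x|^2] ([Lagr_growth]). The integrands are measurable: [f] and [L]
    are exhausted through rational arguments ([measurable_Caratheodory],
    [measurable_Lagr]), and [F] is handled by Tonelli's theorem
    ([measurable_Fprim]). Finally [(m_s, v_s)] is again a competitor ([CE2_interp]).
    There the curve is the mixture of the two curves; it is absolutely continuous
    because mixing couplings bounds the distance of mixtures by the sum of the distances
    ([W2_mixture]), and it represents [m_s] by an argument that avoids the
    measurability in [t] of the masses of the sections of a set
    ([disintegrates_mixture]). *)

(** * Caratheodory integrands and the congestion primitive *)

Lemma continuous_max0 (R : realType) (h : R -> R) :
  {within `[0, +oo[, continuous h} -> continuous (fun s : R => h (Num.max s 0)).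
Proof.
move=> /subspace_continuousP ch s.
have max0_ge0 (t : R) : `[0, +oo[%classic (Num.max t 0).
  by rewrite /= in_itv/= andbT le_max lexx orbT.
apply: (cvg_comp (fun t : R => Num.max t 0)); last exact: (ch _ (max0_ge0 s)).
move=> A wA.
have cmax : {for s, continuous (fun t : R => Num.max t 0)}.
  by apply: (@continuous_max _ R idfun (fun=> 0) s); [exact: cvg_id|exact: cvg_cst].
change (\forall t \near s, A (Num.max t 0)).
have : \forall t \near s, `[0, +oo[%classic (Num.max t 0) -> A (Num.max t 0).
  exact: (cmax _ wA).
by apply: filterS => t; apply; exact: max0_ge0.
Qed.

(** Monotonicity and continuity in the second argument make the superlevel set
    [g (X t) (s t) > a] the union, over rational [r], of the sets where [r <= s t]
    and [g (X t) r > a]; in each of them the second argument of [g] is constant. *)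
Lemma measurable_Caratheodory (R : realType) (n : nat) (g : 'rV[R]_n -> R -> R)
    d (T : measurableType d) (D : set T) (X : T -> 'rV[R]_n) (s : T -> R) :
    (forall r, measurable_fun setT (g ^~ r)) -> (forall x, continuous (g x)) ->
    (forall x, {homo g x : r t / r <= t}) ->
  measurable_fun D X -> measurable_fun D s ->
  measurable_fun D (fun t => g (X t) (s t)).
Proof.
move=> mg cg ng mX ms mD; apply: (measurability _ (RGenOInfty.measurableE R)) => //.
move=> /= _ [_ [a ->] <-].
rewrite [X in measurable X](_ : _ = \bigcup_(r : rat)
   ((D `&` s @^-1` `[ratr r, +oo[) `&`
    (D `&` (fun t => g (X t) (ratr r)) @^-1` `]a, +oo[))).
  apply: bigcupT_measurable_rat => r; apply: measurableI.
    by apply: ms => //; exact: measurable_itv.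
  have : measurable_fun D (fun t => g (X t) (ratr r)).
      exact: (measurableT_comp (mg (ratr r)) mX).
  by apply => //; exact: measurable_itv.
apply/seteqP; split=> [t [Dt]|t [r _ [[Dt +] [_ +]]]] /=; rewrite !in_itv/= !andbT.
  move=> ag.
  have : \forall u \near s t, a < g (X t) u by exact: (cvgr_gt _ (cg _ _) _ ag).
  move=> /nbhs_ballP[e /= e0 eg].
  have [r /[!in_itv]/= /andP[r1 r2]] : exists q : rat, ratr q \in `](s t - e), (s t)[.
    by apply: rat_in_itvoo; rewrite gtrBl.
  exists r => //; rewrite /= !in_itv/= !andbT; split; split=> //; first exact: ltW.
  by apply: eg; rewrite /ball/= gtr0_norm ?subr_gt0// ltrBlDl -ltrBlDr.
rewrite !in_itv/= !andbT => rs ag; split=> //.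
by apply: lt_le_trans ag _; exact: ng.
Qed.

(** The primitive of a nondecreasing function is convex: it lies above its tangent
    at [a]. The point [b] may be on either side of [a]. *)
Lemma Rintegral_chord (R : realType) (h : R -> R) (a b : R) :
    continuous h -> {homo h : r t / r <= t} -> 0 <= a -> 0 <= b ->
  h a * (b - a) <=
    \int[lebesgue_measure]_(t in `[0, b]) h t - \int[lebesgue_measure]_(t in `[0, a]) h t.
Proof.
move=> ch nh.
have icc (k : R -> R) (x y : R) : continuous k ->
    lebesgue_measure.-integrable `[x, y] (EFin \o k).
  move=> ck; apply: continuous_compact_integrable; first exact: segment_compact.
  exact: continuous_subspaceT.
have ioc (k : R -> R) (x y : R) : continuous k ->
    lebesgue_measure.-integrable `]x, y] (EFin \o k).
  by move=> /(icc _ x y); apply: integrableS => //; exact: subset_itv_oc_cc.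
have leb (x y : R) : x <= y -> fine (lebesgue_measure (`]x, y] : set R)) = y - x.
  move=> xy; rewrite lebesgue_measure_itv/= lte_fin; case: ltP => [//|yx].
  by rewrite (@le_anti _ _ x y) ?xy// subrr.
have icst (x y c : R) : lebesgue_measure.-integrable `]x, y] (EFin \o (fun=> c)).
  by apply: ioc => t; exact: cvg_cst.
move=> a0 b0; have [ab|/ltW ba] := leP a b.
  rewrite Rintegral_itvB ?bnd_simp//; last exact: icc.
  rewrite -leb// -Rintegral_cst//; apply: le_Rintegral;
    [by []|exact: icst|exact: ioc|move=> t /=].
  by rewrite in_itv/= => /andP[/ltW ? _]; exact: nh.
rewrite -(opprB a b) mulrN lerNl opprB Rintegral_itvB ?bnd_simp//; last exact: icc.
rewrite -leb// -Rintegral_cst//; apply: le_Rintegral;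
  [by []|exact: ioc|exact: icst|move=> t /=].
by rewrite in_itv/= => /andP[_ ?]; exact: nh.
Qed.

Section congestion_primitive.
Context {R : realType} {n : nat} {p q : R} {f : 'rV[R]_n -> R -> R}.
Hypothesis hf : f_assumptions p q f.

(** The congestion [f x] is meaningful on nonnegative densities only. Extended
    to negative ones by its value at [0], it becomes continuous and nondecreasing on the
    whole line. *)
Definition extend0 (g : 'rV[R]_n -> R -> R) (x : 'rV[R]_n) (s : R) : R :=
  g x (Num.max s 0).

Lemma extend0E x s : 0 <= s -> extend0 f x s = f x s.
Proof. by move=> s0; rewrite /extend0 max_l. Qed.

Lemma extend0_continuous x : continuous (extend0 f x).
Proof. by apply: continuous_max0; exact: (f_continuous hf). Qed.

Lemma extend0_homo x : {homo extend0 f x : s t / s <= t}.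
Proof.
move=> s t st; apply: (f_increasing hf); first by rewrite le_max lexx orbT.
by rewrite ge_max le_max st le_max lexx orbT.
Qed.

Lemma measurable_extend0 {d} {T : measurableType d} {D : set T}
    {X : T -> 'rV[R]_n} {s : T -> R} :
  measurable_fun D X -> measurable_fun D s ->
  measurable_fun D (fun t => extend0 f (X t) (s t)).
Proof.
apply: measurable_Caratheodory.
- by move=> r; apply: (f_measurable hf); rewrite le_max lexx orbT.
- exact: extend0_continuous.
- exact: extend0_homo.
Qed.

Lemma FprimE x s : Fprim f x s = \int[lebesgue_measure]_(t in `[0, s]) extend0 f x t.
Proof.
apply: eq_Rintegral => t; rewrite inE/= in_itv/= => /andP[t0 _].
by rewrite extend0E.
Qed.

(** Exchanging [a] and [b] bounds the increment of the primitive from above. *)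
Lemma Fprim_convex x a b : 0 <= a -> 0 <= b ->
  f x a * (b - a) <= Fprim f x b - Fprim f x a.
Proof.
move=> a0 b0; rewrite !FprimE -extend0E//; apply: Rintegral_chord => //.
- exact: extend0_continuous.
- exact: extend0_homo.
Qed.

(** The tangents at [0] and at [s] enclose the primitive, so the growth of [f] alone
    controls it. *)
Lemma Fprim_abs_le x s : 0 <= s -> `|Fprim f x s| <= `|f x 0 * s| + `|f x s * s|.
Proof.
move=> s0; have F0 : Fprim f x 0 = 0.
  by rewrite /Fprim set_itv1 Rintegral_set1.
have := Fprim_convex x 0 s (lexx 0) s0; have := Fprim_convex x s 0 s0 (lexx 0).
rewrite F0 !subr0 !sub0r mulrN lerN2 => Fle leF.
have [F_ge0|F_lt0] := leP 0 (Fprim f x s).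
  rewrite ger0_norm//; apply: le_trans Fle _.
  by rewrite (le_trans (ler_norm _))// lerDr.
rewrite ltr0_norm// (@le_trans _ _ (- (f x 0 * s)))// ?lerN2//.
by rewrite -normrN (le_trans (ler_norm _))// lerDl.
Qed.

(** Splitting off [f x 0] leaves a nonnegative integrand, to which Tonelli's
    theorem applies. *)
Let measurable_FprimT d (T : measurableType d) (X : T -> 'rV[R]_n) (s : T -> R) :
    (forall t, 0 <= s t) -> measurable_fun setT X -> measurable_fun setT s ->
  measurable_fun setT (fun t => Fprim f (X t) (s t)).
Proof.
move=> s0 mX ms.
(* As the integrand vanishes at negative r, the cut-off at s leaves [0, s]. *)
pose k (z : T * measurableTypeR R) : R :=
  if z.2 <= s z.1 then extend0 f (X z.1) z.2 - extend0 f (X z.1) 0 else 0.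
have k0 z : 0 <= k z.
  rewrite /k; case: ifPn => // _; have [z0|/ltW z0] := leP 0 z.2.
    by rewrite subr_ge0; exact: extend0_homo.
  by rewrite /extend0 max_r// max_l// subrr.
have mk : measurable_fun setT k.
  have mX1 : measurable_fun setT (fun z : T * measurableTypeR R => X z.1).
    exact: (measurableT_comp mX measurable_fst).
  apply: measurable_fun_ifT.
  - apply: measurable_fun_ler; first exact: measurable_snd.
    exact: (measurableT_comp ms measurable_fst).
  - apply: measurable_funB.
      exact: (measurable_extend0 mX1 measurable_snd).
    exact: (@measurable_extend0 _ _ _ _ (fun=> 0) mX1 (measurable_cst _)).
  - exact: measurable_cst.
have FE t : Fprim f (X t) (s t) =
    fine (\int[lebesgue_measure]_r (k (t, r))%:E) + f (X t) 0 * s t.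
  have i0 (h : R -> R) : continuous h ->
      lebesgue_measure.-integrable `[0, s t] (EFin \o h).
    move=> ch; apply: continuous_compact_integrable; first exact: segment_compact.
    exact: continuous_subspaceT.
  have -> : fine (\int[lebesgue_measure]_r (k (t, r))%:E) =
      \int[lebesgue_measure]_(r in `[0, s t]) (extend0 f (X t) r - f (X t) 0).
    rewrite [RHS]Rintegral_mkcond; congr fine; apply: eq_integral => r _.
    rewrite patchE /k/=; congr EFin; case: ifPn => rs; case: ifPn => //.
    - by rewrite (extend0E (X t) 0).
    - move=> /negP; rewrite inE/= in_itv/= rs andbT => /negP; rewrite -ltNge => /ltW r0.
      by rewrite /extend0 max_r// max_l// subrr.
    - by rewrite inE/= in_itv/= (negbTE rs) andbF.
  rewrite RintegralB//; [|exact/i0/extend0_continuous|].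
    have leb : fine (lebesgue_measure (`[0, s t] : set R)) = s t.
      rewrite lebesgue_measure_itv/= lte_fin.
      case: ltP => [_|s_le0]; first by rewrite /= oppr0 addr0.
      by apply: le_anti; rewrite s_le0 s0.
    by rewrite -FprimE Rintegral_cst// leb subrK.
  by apply: (i0 (fun=> f (X t) 0)) => r; exact: cvg_cst.
apply: (eq_measurable_fun _ (fun t _ => esym (FE t))).
apply: measurable_funD; last first.
  have mf0 := f_measurable hf (lexx 0).
  by apply: measurable_funM => //; exact: (measurableT_comp mf0 mX).
apply: (measurableT_comp (@fine_measurable R setT measurableT)).
have := @measurable_fun_fubini_tonelli_F _ _ T (measurableTypeR R) R
  lebesgue_measure (EFin \o k).
by apply => [|z /=]; [exact/measurable_EFinP|rewrite lee_fin].
Qed.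

Lemma measurable_Fprim d (T : measurableType d) (D : set T) (X : T -> 'rV[R]_n)
    (s : T -> R) :
    measurable D -> (forall t, D t -> 0 <= s t) ->
  measurable_fun setT X -> measurable_fun D s ->
  measurable_fun D (fun t => Fprim f (X t) (s t)).
Proof.
move=> mD s0 mX /(measurable_restrictT s mD) ms.
have h : measurable_fun setT (fun t => Fprim f (X t) ((s \_ D) t)).
  apply: measurable_FprimT => // t; rewrite patchE; case: ifPn => //.
  by rewrite inE; exact: s0.
apply: (eq_measurable_fun (fun t => Fprim f (X t) ((s \_ D) t))).
  by move=> t Dt; rewrite patchE Dt.
exact: measurable_funTS.
Qed.

End congestion_primitive.

(** * The Lagrangian as a supremum of affine functions *)

Section euclidean.
Context {R : realType} {n : nat}.
Implicit Types x y v xi : 'rV[R]_n.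

Lemma dotp_ge0 x : 0 <= dotp x x.
Proof. by apply: sumr_ge0 => i _; rewrite -expr2 sqr_ge0. Qed.

Lemma enorm_ge0 x : 0 <= enorm x.
Proof. exact: sqrtr_ge0. Qed.

Lemma enormE x : enorm x ^+ 2 = dotp x x.
Proof. by rewrite sqr_sqrtr// dotp_ge0. Qed.

Lemma enorm_sqr x : enorm x ^+ 2 = \sum_i x ord0 i ^+ 2.
Proof. by rewrite enormE; apply: eq_bigr => i _; rewrite expr2. Qed.

Lemma enorm0 : enorm (0 : 'rV[R]_n) = 0.
Proof. by rewrite /enorm /dotp big1 ?sqrtr0// => i _; rewrite mxE mul0r. Qed.

Lemma sqr_coord_le x i : x ord0 i ^+ 2 <= enorm x ^+ 2.
Proof.
rewrite enorm_sqr (bigD1 i)//= lerDl.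
by apply: sumr_ge0 => j _; exact: sqr_ge0.
Qed.

(** The defect of convexity of the square is [a * b * (x_i - y_i) ^+ 2] in each
    coordinate. *)
Lemma enorm_conv (a b : R) x y : 0 <= a -> 0 <= b ->  a + b = 1 ->
  enorm (a *: x + b *: y) ^+ 2 <= a * enorm x ^+ 2 + b * enorm y ^+ 2.
Proof.
move=> a0 b0 ab; rewrite !enorm_sqr !mulr_sumr -big_split/=.
apply: ler_sum => i _; rewrite !mxE.
rewrite -subr_ge0 (_ : _ - _ = a * b * (x ord0 i - y ord0 i) ^+ 2).
  by rewrite mulr_ge0 ?sqr_ge0// mulr_ge0.
have -> : b = 1 - a by lra.
ring.
Qed.

(** Completing the square [(c * v_i + xi_i) ^+ 2] in each coordinate; this is the
    Legendre transform of the quadratic lower bound on the Hamiltonian. *)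
Lemma dotp_young (c : R) v xi : 0 < c ->
  - dotp v xi <= c / 2 * enorm v ^+ 2 + (2 * c)^-1 * enorm xi ^+ 2.
Proof.
move=> c0; rewrite !enorm_sqr !mulr_sumr -big_split/= -sumrN.
apply: ler_sum => i _; set s := v _ _; set t := xi _ _.
rewrite -subr_ge0 (_ : _ - _ = (2 * c)^-1 * (c * s + t) ^+ 2).
  by rewrite mulr_ge0// ?sqr_ge0// invr_ge0; lra.
by field; rewrite gt_eqF.
Qed.

Lemma measurable_dotp d (T : measurableType d) (D : set T) (X Y : T -> 'rV[R]_n) :
  measurable_fun D X -> measurable_fun D Y ->
  measurable_fun D (fun t => dotp (X t) (Y t)).
Proof.
move=> mX mY; apply: measurable_sum => i.
by apply: measurable_funM; exact: (measurableT_comp (measurable_rV_coord i)).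
Qed.

Lemma measurable_enorm2 d (T : measurableType d) (D : set T) (X : T -> 'rV[R]_n) :
  measurable_fun D X -> measurable_fun D (fun t => enorm (X t) ^+ 2).
Proof.
move=> mX; rewrite (_ : (fun _ => _) = fun t => dotp (X t) (X t)).
  exact: measurable_dotp.
by apply/funext => t; rewrite enormE.
Qed.

Lemma dotp_continuous v : continuous (dotp v).
Proof.
move=> xi; have Fxi : Filter (nbhs xi) by exact: nbhs_filter.
apply: cvg_big => [|i _]; first exact: add_continuous.
by apply: cvgM; [exact: cvg_cst|exact: coord_continuous].
Qed.

Lemma rat_rV_dense (xi : 'rV[R]_n) (A : set 'rV[R]_n) : nbhs xi A ->
  exists r : 'rV[rat]_n, A (map_mx ratr r).
Proof.
move=> /nbhs_ballP[e /= e0 eA].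
have /choice[r xr] i : exists r : rat, `|xi ord0 i - ratr r| < e.
  have [|r] := @rat_in_itvoo _ (xi ord0 i - e) (xi ord0 i + e); first lra.
  rewrite in_itv/= => /andP[r1 r2]; exists r.
  by rewrite ltr_distlC r1.
exists (\row_i r i); apply: eA; split=> // i j.
by rewrite !mxE ord1 -ball_normE/=.
Qed.

End euclidean.

Section lagrangian.
Context {R : realType} {n : nat} {H : 'rV[R]_n -> 'rV[R]_n -> R}.
Hypothesis hH : H_assumptions H.

(** By continuity of [H x], the supremum may be restricted to the countably many
    rational momenta. *)
Lemma measurable_Lagr d (T : measurableType d) (D : set T) (X V : T -> 'rV[R]_n) :
  measurable_fun setT X -> measurable_fun D V ->
  measurable_fun D (fun t => Lagr H (X t) (V t)).
Proof.
move=> mX mV mD; apply: (measurability _ (ErealGenOInfty.measurableE R)) => //.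
move=> /= _ [_ [a ->] <-].
pose h (xi : 'rV[R]_n) t := - dotp (V t) xi - H (X t) xi.
have mh xi : measurable_fun D (h xi).
  apply: measurable_funB.
    by apply: measurable_funN; apply: measurable_dotp.
  apply: measurable_funTS; exact: (measurableT_comp (H_measurable hH xi) mX).
rewrite [X in measurable X](_ : _ = \bigcup_(r : 'rV[rat]_n)
   (D `&` h (map_mx ratr r) @^-1` `]a, +oo[)).
  apply: countable_bigcupT_measurable => // r.
  by apply: mh => //; exact: measurable_itv.
apply/seteqP; split=> [t [Dt]|t [r _ [Dt]]] /=; rewrite !in_itv/= !andbT.
  move=> /ereal_sup_gt[_ [xi _ <-]]; rewrite lte_fin => ah.
  have : \forall y \near xi, a < h y t.
    have ch : h y t @[y --> xi] --> h xi t.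
      rewrite /h; apply: (@cvgB _ _ _ (nbhs xi)); last exact: (H_continuous hH).
      by apply: (@cvgN _ _ _ (nbhs xi)); exact: dotp_continuous.
    exact: (cvgr_gt _ ch _ ah).
  move=> /rat_rV_dense[r ar]; exists r => //; split=> //=.
  by rewrite in_itv/= andbT.
move=> ah; split=> //; apply: (@lt_le_trans _ _ (h (map_mx ratr r) t)%:E).
  by rewrite lte_fin.
by apply: ereal_sup_ubound; exists (map_mx ratr r).
Qed.

Lemma Lagr_ge x v xi : ((- dotp v xi - H x xi)%:E <= Lagr H x v)%E.
Proof. by apply: ereal_sup_ubound; exists xi. Qed.

(** The quadratic lower bound on [H] bounds the supremum from above, and the momentum
    [0] bounds it from below. In particular the Lagrangian is finite off a null set. *)
Lemma Lagr_growth : exists C : R, 0 <= C /\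
  {ae lebesgue_rV n, forall x, forall v,
     (`|Lagr H x v| <= (C * (enorm v ^+ 2 + kappa x))%:E)%E}.
Proof.
have [c [cm [cp [c1 cm0 cp0 Hg]]]] := H_growth hH.
exists (c + cm + 2 * cp); split; first lra.
apply: filterS Hg => x Hx v.
have x0 := enorm_ge0 x; have v0 := sqr_ge0 (enorm v).
have x1 : enorm x <= 1 + enorm x ^+ 2 by nra.
have c2 : 0 < (2 * c)^-1 by rewrite invr_gt0; lra.
have Lub : (Lagr H x v <= ((c + cm + 2 * cp) * (enorm v ^+ 2 + kappa x))%:E)%E.
  apply: ge_ereal_sup => _ [xi _ <-]; rewrite lee_fin.
  have /andP[Hl _] := Hx xi.
  have := @dotp_young _ _ c v xi (lt_le_trans ltr01 c1).
  rewrite /kappa; nra.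
have Llb : (- ((c + cm + 2 * cp) * (enorm v ^+ 2 + kappa x))%:E <= Lagr H x v)%E.
  apply: (le_trans _ (Lagr_ge x v 0)); rewrite -EFinN lee_fin.
  have /andP[_] := Hx 0; rewrite enorm0 expr0n/= mulr0 add0r.
  have -> : dotp v 0 = 0 by rewrite /dotp big1// => i _; rewrite mxE mulr0.
  rewrite /kappa; nra.
move: Llb Lub; case: (Lagr H x v) => [l||]; rewrite -?EFinN ?leeNy_eq ?leye_eq//=.
by rewrite !lee_fin => lb ub; rewrite ler_norml lb ub.
Qed.

(** Joint convexity of the kinetic energy in density and flux. For a fixed momentum
    [xi] the expression [(- dotp w xi - H x xi) * m] is linear in the pair formed by
    [m] and the flux [m *: w]; the energy is the supremum of these. *)
Lemma Lagr_convex (a b m m' : R) x (v v' w : 'rV[R]_n) :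
    0 < a -> 0 < b -> 0 <= m -> 0 <= m' ->
    (a * m + b * m') *: w = (a * m) *: v + (b * m') *: v' ->
  (Lagr H x w * (a * m + b * m')%:E <=
   a%:E * (Lagr H x v * m%:E) + b%:E * (Lagr H x v' * m'%:E))%E.
Proof.
move=> a0 b0 m0 m'0 wE; set ms := a * m + b * m'.
have am0 := mulr_ge0 (ltW a0) m0; have bm0 := mulr_ge0 (ltW b0) m'0.
have := addr_ge0 am0 bm0.
rewrite le_eqVlt => /predU1P[|ms0].
  move=> /esym/eqP; rewrite /ms paddr_eq0//.
  rewrite !mulf_eq0 (gt_eqF a0) (gt_eqF b0)/= => /andP[/eqP-> /eqP->].
  by rewrite !mulr0 addr0 !mule0 adde0.
rewrite -lee_pdivlMr//; apply: ge_ereal_sup => _ [xi _ <-].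
rewrite lee_pdivlMr//.
have -> : ((- dotp w xi - H x xi)%:E * ms%:E =
    a%:E * ((- dotp v xi - H x xi)%:E * m%:E) +
    b%:E * ((- dotp v' xi - H x xi)%:E * m'%:E))%E.
  rewrite -!EFinM -EFinD; congr EFin.
  have : ms * dotp w xi = a * m * dotp v xi + b * m' * dotp v' xi.
    rewrite /dotp !mulr_sumr -big_split/=; apply: eq_bigr => i _.
    rewrite !mulrA -mulrDl; congr (_ * _).
    by have /rowP/(_ i) := wE; rewrite !mxE.
  by move=> dE; rewrite mulrBl mulNr [_ * ms]mulrC dE /ms; ring.
by apply: leeD; rewrite lee_pmul2l ?lte_fin// lee_wpmul2r ?lee_fin//; exact: Lagr_ge.
Qed.

End lagrangian.

(** * Integrability of the costs over the space-time cylinder *)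

Section measure_lemmas.
Context {d} {T : measurableType d} {R : realType} {mu : {measure set T -> \bar R}}.

Lemma ae_le_integrable {D : set T} {f g : T -> \bar R} :
    measurable D -> measurable_fun D f ->
    {ae mu, forall t, D t -> (`|f t| <= `|g t|)%E} ->
  mu.-integrable D g -> mu.-integrable D f.
Proof.
move=> mD mf fg /integrableP[mg ig]; apply/integrableP; split=> //.
apply: le_lt_trans ig; apply: ae_ge0_le_integral => //; exact: measurableT_comp.
Qed.

Lemma Lp_on_integrable {D : set T} {p : R} {u : T -> R} :
  Lp_on mu D p u -> mu.-integrable D (fun t => (`|u t| `^ p)%:E).
Proof.
move=> [mu_ iu]; apply/integrableP; split.
  apply/measurable_EFinP; apply: (measurableT_comp (measurable_powR p)).
  exact: measurableT_comp.
by under eq_integral do rewrite gee0_abs ?lee_fin ?powR_ge0//.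
Qed.

(** A weakened Young inequality, by comparing [a] with [b]. *)
Lemma powR_mul_le (p a b : R) : 1 < p -> 0 <= a -> 0 <= b ->
  a `^ (p - 1) * b <= a `^ p + b `^ p.
Proof.
move=> p1 a0 b0; have p0 : 0 < p by lra.
have pm : 0 <= p - 1 by lra.
have [ab|/ltW ba] := leP a b.
  apply: (@le_trans _ _ (b `^ (p - 1) * b)).
    by rewrite ler_wpM2r// ge0_ler_powR.
  by rewrite mulrC mulr_powRB1// lerDr powR_ge0.
apply: (@le_trans _ _ (a `^ (p - 1) * a)).
  by rewrite ler_wpM2l// powR_ge0.
by rewrite mulrC mulr_powRB1// lerDl powR_ge0.
Qed.

Lemma powRD_le (r a b : R) : 0 <= r ->
  `|a + b| `^ r <= 2 `^ r * (`|a| `^ r + `|b| `^ r).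
Proof.
move=> r0; apply: (@le_trans _ _ ((2 * Num.max `|a| `|b|) `^ r)).
  apply: ge0_ler_powR => //; rewrite ?nnegrE ?normr_ge0 ?mulr_ge0 ?le_max ?normr_ge0//.
  apply: (le_trans (ler_normD _ _)); rewrite mulr_natl mulr2n.
  by apply: lerD; rewrite le_max lexx ?orbT.
rewrite powRM ?le_max ?normr_ge0// ler_wpM2l ?powR_ge0//.
by have [ab|ba] := leP `|a| `|b|; rewrite ?lerDl ?lerDr powR_ge0.
Qed.

Lemma Lp_onD {D : set T} {r : R} {u w : T -> R} : measurable D -> 0 <= r ->
  Lp_on mu D r u -> Lp_on mu D r w -> Lp_on mu D r (u \+ w).
Proof.
move=> mD r0 Lu Lw; have mD_uw := measurable_funD Lu.1 Lw.1; split=> //.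
have iu := Lp_on_integrable Lu; have iw := Lp_on_integrable Lw.
have mpow : measurable_fun D (fun t => (`|u t + w t| `^ r)%:E).
  apply/measurable_EFinP; apply: (measurableT_comp (measurable_powR r)).
  exact: measurableT_comp mD_uw.
have : mu.-integrable D (fun t => (`|u t + w t| `^ r)%:E).
  apply: (le_integrable mD mpow); last first.
    exact: (integrableZl mD (2 `^ r) (integrableD mD iu iw)).
  move=> t _ /=; rewrite lee_fin ger0_norm ?powR_ge0//.
  by rewrite (le_trans (powRD_le r (u t) (w t) r0))// ler_norm.
move=> /integrableP[_]; under eq_integral do rewrite gee0_abs ?lee_fin ?powR_ge0//.
by [].
Qed.

Lemma Lp_on0 {D : set T} {r : R} : 0 < r -> Lp_on mu D r (fun=> 0).
Proof.
move=> r0; split; first exact: measurable_cst.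
by under eq_integral do rewrite normr0 powR0 ?gt_eqF//; rewrite integral0.
Qed.

Lemma Lp_onZ {D : set T} {r : R} (c : R) {u : T -> R} : measurable D -> 0 <= r ->
  Lp_on mu D r u -> Lp_on mu D r (fun t => c * u t).
Proof.
move=> mD r0 Lu; have mc : measurable_fun D (fun t => c * u t).
  by apply: measurable_funM => //; exact: Lu.1.
split=> //; have := integrable_lty mD (integrableZl mD (`|c| `^ r) (Lp_on_integrable Lu)).
by under eq_integral do rewrite /= -EFinM -powRM ?normr_ge0// -normrM.
Qed.

End measure_lemmas.

Section spacetime.
Context {R : realType} {n : nat}.

Local Notation TX := (measurableTypeR R * 'rV[R]_n)%type.

(* The measure on space-time uses the Borel structure generated by half-open
   intervals, whose display differs from the default one on [R]; [TX] selects it. *)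
Lemma measurable_Q : measurable (@Q R n : set TX).
Proof. exact: measurableX. Qed.

Lemma ae_space {P : 'rV[R]_n -> Prop} :
  {ae lebesgue_rV n, forall x, P x} -> {ae @lebesgue_tx R n, forall z, P z.2}.
Proof.
move=> [N [mN N0 PN]]; exists (setT `*` N); split.
- exact: measurableX.
- by rewrite /lebesgue_tx product_measure1E// N0 mule0.
- by move=> z /= Pz; split=> //; exact: PN.
Qed.

(** The time interval has length [1]. *)
Lemma integrable_space {g : 'rV[R]_n -> R} :
  (lebesgue_rV n).-integrable setT (EFin \o g) ->
  (@lebesgue_tx R n).-integrable (@Q R n) (fun z => (g z.2)%:E).
Proof.
move=> /integrableP[mg ig].
have mg2 : measurable_fun setT (fun z : TX => (g z.2)%:E).
  exact: (measurableT_comp mg measurable_snd).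
apply/integrableP; split; first exact: measurable_funTS.
rewrite integral_mkcond /lebesgue_tx fubini_tonelli1; last 2 first.
- apply/(measurable_restrictT _ measurable_Q); apply: measurable_funTS.
  exact: measurableT_comp.
- by move=> z; rewrite patchE; case: ifPn => // _; exact: abse_ge0.
pose c := (\int[lebesgue_rV n]_x `|(g x)%:E|)%E.
rewrite (_ : (fun t => _) = (cst c) \_ `]0, 1[); last first.
  apply/funext => t; rewrite /fubini_F patchE; case: ifPn => t01.
    apply: eq_integral => x _; rewrite patchE ifT//.
    by rewrite inE; split=> //; rewrite inE in t01.
  rewrite integral0_eq// => x _; rewrite patchE ifF//.
  by apply/negP; rewrite inE => -[t01' _]; move: t01; rewrite notin_setE.
rewrite -integral_mkcond integral_cst//.
have l01 : lebesgue_measure (`]0, 1[ : set R) = 1%E.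
  by rewrite lebesgue_measure_itv/= lte01 oppr0 addr0.
by rewrite [X in (_ * X < _)%E]l01 mule1.
Qed.

End spacetime.

Section integrability.
Context {R : realType} {n : nat} {p q : R}.
Hypotheses (hp : 1 < p) (hq : 1 < q) (hpq : p^-1 + q^-1 = 1).
Let mu : {measure set (measurableTypeR R * 'rV[R]_n)%type -> \bar R} := @lebesgue_tx R n.
Local Notation TX := (measurableTypeR R * 'rV[R]_n)%type.
Let mQ : measurable (@Q R n : set TX) := measurable_Q.

(** The growth condition bounds [f x u * w] by [u `^ (p - 1) * w] and [gamma x * w],
    and Young's inequality bounds these by the [p]-th powers of [u] and [w] and the
    [q]-th power of [gamma], all integrable. *)
Lemma integrable_congestion {f : 'rV[R]_n -> R -> R} {u w : R * 'rV[R]_n -> R} :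
    f_assumptions p q f ->
    (forall z, Q z -> 0 <= u z) -> (forall z, Q z -> 0 <= w z) ->
    Lp_on mu Q p u -> Lp_on mu Q p w ->
  mu.-integrable Q (fun z => (f z.2 (u z) * w z)%:E).
Proof.
move=> hf u0 w0 Lu Lw; have [c [gamma [c1 g0 gq growth]]] := f_growth hf.
have iu := Lp_on_integrable Lu.
have iw := Lp_on_integrable Lw.
have ig := integrable_space (Lfun_integrable (ltW hq) gq).
have mfw : measurable_fun Q (fun z : TX => (f z.2 (u z) * w z)%:E).
  apply/measurable_EFinP; apply: measurable_funM; last exact: Lw.1.
  apply: (@eq_measurable_fun _ _ _ _ _ (fun z => extend0 f z.2 (u z))).
    by move=> z; rewrite inE => Qz; rewrite extend0E// u0.
  apply: (measurable_extend0 hf _ Lu.1); apply: measurable_funTS.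
  exact: measurable_snd.
have ibound := integrableD mQ ig
  (integrableZl mQ (c `^ p + 1) (integrableD mQ iu iw)).
apply: (ae_le_integrable mQ mfw _ ibound).
apply: filterS (ae_space growth) => z fz Qz /=.
rewrite lee_fin; apply: le_trans (ler_norm _).
have uz := u0 z Qz; have wz := w0 z Qz; have gz := g0 z.2.
have /andP[fl fu] := fz _ uz.
rewrite normrM (ger0_norm wz) (ger0_norm uz) (ger0_norm gz).
have cu : 0 <= c `^ (- p) * u z `^ (p - 1) by rewrite mulr_ge0// powR_ge0.
have cu' : 0 <= c `^ p * u z `^ (p - 1) by rewrite mulr_ge0// powR_ge0.
have fle : `|f z.2 (u z)| <= c `^ p * u z `^ (p - 1) + gamma z.2.
  by rewrite ler_norml; apply/andP; split; lra.
apply: (le_trans (ler_wpM2r wz fle)).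
rewrite mulrDl -mulrA.
have h1 := ler_wpM2l (powR_ge0 c p) (powR_mul_le p (u z) (w z) hp uz wz).
have qp : q^-1 + p^-1 = 1 by rewrite addrC.
have h2 := conjugate_powR gz wz (lt_trans ltr01 hq) (lt_trans ltr01 hp) qp.
have up := powR_ge0 (u z) p; have wp := powR_ge0 (w z) p.
have gp := powR_ge0 (gamma z.2) q.
have h3 : gamma z.2 `^ q / q <= gamma z.2 `^ q.
  by rewrite ler_pdivrMr ?(lt_trans ltr01)// ler_peMr// ltW.
have h4 : w z `^ p / p <= w z `^ p.
  by rewrite ler_pdivrMr ?(lt_trans ltr01)// ler_peMr// ltW.
lra.
Qed.

Lemma integrable_Fprim {f : 'rV[R]_n -> R -> R} {u : R * 'rV[R]_n -> R} :
    f_assumptions p q f -> (forall z, Q z -> 0 <= u z) -> Lp_on mu Q p u ->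
  mu.-integrable Q (fun z => (Fprim f z.2 (u z))%:E).
Proof.
move=> hf u0 Lu.
have L0 : Lp_on mu Q p (fun=> 0) := Lp_on0 (lt_trans ltr01 hp).
have ifz := integrable_congestion hf (fun z _ => lexx 0) u0 L0 Lu.
have ifu := integrable_congestion hf u0 u0 Lu Lu.
have mF : measurable_fun Q (fun z : TX => (Fprim f z.2 (u z))%:E).
  apply/measurable_EFinP.
  exact: (measurable_Fprim hf _ _ _ _ _ mQ u0 measurable_snd Lu.1).
apply: (le_integrable mQ mF); last first.
  exact: (integrableD mQ (integrable_abse ifz) (integrable_abse ifu)).
move=> z Qz /=; rewrite lee_fin; apply: le_trans (ler_norm _).
exact: (Fprim_abs_le hf _ _ (u0 z Qz)).
Qed.

Lemma integrable_Lagr {H : 'rV[R]_n -> 'rV[R]_n -> R} {u : R * 'rV[R]_n -> R}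
    {v : R * 'rV[R]_n -> 'rV[R]_n} :
    H_assumptions H -> (forall z, Q z -> 0 <= u z) -> @measurable_fun _ _ TX _ Q u ->
    mu.-integrable Q (fun z => (kappa z.2 * u z)%:E) -> @measurable_fun _ _ TX _ Q v ->
    mu.-integrable Q (fun z => (enorm (v z) ^+ 2 * u z)%:E) ->
  mu.-integrable Q (fun z => Lagr H z.2 (v z) * (u z)%:E)%E.
Proof.
move=> hH u0 mu_ ik mv iv; have [C [C0 growth]] := Lagr_growth hH.
have mL : measurable_fun Q (fun z : TX =>
    Lagr H z.2 (v z) * (u z)%:E)%E.
  apply: emeasurable_funM; last exact/measurable_EFinP.
  exact: (measurable_Lagr hH _ _ _ _ _ measurable_snd mv).
apply: (ae_le_integrable mQ mL _ (integrableZl mQ C (integrableD mQ iv ik))).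
apply: filterS (ae_space growth) => z Lz Qz /=.
rewrite abseM (gee0_abs (x := (u z)%:E)) ?lee_fin ?u0//.
apply: (le_trans (lee_wpmul2r _ (Lz (v z)))); first by rewrite lee_fin u0.
by rewrite -EFinM lee_fin (le_trans _ (ler_norm _))// -mulrA mulrDl.
Qed.

End integrability.

(** * Integrals of possibly nonmeasurable functions *)

Section superadditivity.
Import HBNNSimple.
Context {d : measure_display} {T : measurableType d} {R : realType}.
Context {mu : {measure set T -> \bar R}}.
Local Open Scope ereal_scope.

(** Monotonicity holds without measurability, since only more simple functions lie
    below a larger function. *)
Lemma ge0_le_integral_nonmeasurable (D : set T) (f g : T -> \bar R) :
    (forall t, D t -> 0 <= f t) -> (forall t, D t -> f t <= g t) ->
  \int[mu]_(t in D) f t <= \int[mu]_(t in D) g t.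
Proof.
move=> f0 fg; rewrite !ge0_integralE//; last first.
  by move=> t Dt; apply: le_trans (fg t Dt); exact: f0.
apply: ereal_sup_le => _ [h hf <-]; exists h => // t.
apply: (le_trans (hf t)); rewrite !patchE; case: ifPn => // /set_mem; exact: fg.
Qed.

Let simple_below (D : set T) (f : T -> \bar R) (e : R) :
    (forall t, D t -> 0 <= f t) -> (0 < e)%R -> \int[mu]_(t in D) f t \is a fin_num ->
  exists h : {nnsfun T >-> R}, (forall t, (h t)%:E <= (f \_ D) t) /\
    \int[mu]_(t in D) f t <= sintegral mu h + e%:E.
Proof.
move=> f0 e0; rewrite ge0_integralE// => ffin.
have [_ [h hf <-] /ltW hlt] := ub_ereal_sup_adherent e0 ffin.
by exists h; split=> //; rewrite -leeBlDr.
Qed.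

(** For a function that is not known to be measurable, the integral is a supremum
    over the simple functions below it, hence only superadditive. *)
Lemma ge0_integral_superadd (D : set T) (f g : T -> \bar R) (a b : R) :
    (0 <= a)%R -> (0 <= b)%R ->
    (forall t, D t -> 0 <= f t) -> (forall t, D t -> 0 <= g t) ->
    \int[mu]_(t in D) f t \is a fin_num -> \int[mu]_(t in D) g t \is a fin_num ->
  a%:E * \int[mu]_(t in D) f t + b%:E * \int[mu]_(t in D) g t <=
    \int[mu]_(t in D) (a%:E * f t + b%:E * g t).
Proof.
move=> a0 b0 f0 g0 ffin gfin.
apply/lee_addgt0Pr => e e0.
(* The slacks add up to (a + b) e', at most e. *)
have e'0 : (0 < e / (a + b + 1))%R by rewrite divr_gt0//; lra.
have [h [hf fh]] := simple_below D f _ f0 e'0 ffin.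
have [k [kg gk]] := simple_below D g _ g0 e'0 gfin.
have fg0 t : D t -> 0 <= a%:E * f t + b%:E * g t.
  by move=> Dt; rewrite adde_ge0// mule_ge0 ?lee_fin ?f0 ?g0.
pose c := add_nnsfun (scale_nnsfun h a0) (scale_nnsfun k b0).
have cE : sintegral mu c = a%:E * sintegral mu h + b%:E * sintegral mu k.
  rewrite [LHS](sintegralD mu (scale_nnsfun h a0) (scale_nnsfun k b0)).
  by congr (_ + _); exact: sintegralrM.
have cle : sintegral mu c <= \int[mu]_(t in D) (a%:E * f t + b%:E * g t).
  rewrite ge0_integralE//; apply: ereal_sup_ubound; exists c => // t.
  have -> : c t = (a * h t + b * k t)%R by [].
  have := hf t; have := kg t; rewrite !patchE; case: ifPn => _ kt ht.
    by rewrite EFinD !EFinM; apply: leeD; rewrite lee_wpmul2l ?lee_fin.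
  have -> : h t = 0%R by apply: le_anti; rewrite -!lee_fin ht/= lee_fin fun_ge0.
  have -> : k t = 0%R by apply: le_anti; rewrite -!lee_fin kt/= lee_fin fun_ge0.
  by rewrite !mulr0 addr0.
set e' := (e / (a + b + 1))%R in e'0 fh gk.
apply: (@le_trans _ _ (sintegral mu c + e%:E)); last by rewrite leeD2r.
apply: (@le_trans _ _ (a%:E * (sintegral mu h + e'%:E) +
    b%:E * (sintegral mu k + e'%:E))).
  by apply: leeD; rewrite lee_wpmul2l ?lee_fin.
rewrite !ge0_muleDr ?sintegral_ge0 ?lee_fin ?(ltW e'0)// addeACA cE leeD2l//.
rewrite -!EFinM -EFinD lee_fin -mulrDl /e' mulrCA ler_piMr ?(ltW e0)//.
by rewrite ler_pdivrMr ?mul1r; lra.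
Qed.
End superadditivity.

(** * Mixtures of probabilities and of absolutely continuous curves *)

Section mixture.
Context {d : measure_display} {T : measurableType d} {R : realType}.
Context {a b : {nonneg R}} (ab : a%:num + b%:num = 1).

(** The normalisation of the weights is an argument so that the probability
    structure can be inferred from the term. *)
Definition mixture of a%:num + b%:num = 1 := fun P P' : probability T R =>
  (measure_add (mscale a P) (mscale b P') : set T -> \bar R).

Variables (P P' : probability T R).

HB.instance Definition _ := Measure.on (mixture ab P P').

Lemma mixtureE A : mixture ab P P' A = (a%:num%:E * P A + b%:num%:E * P' A)%E.
Proof. by rewrite /mixture measure_addE. Qed.

Let mixture_setT : mixture ab P P' setT = 1%E.
Proof. by rewrite mixtureE !probability_setT !mule1 -EFinD ab. Qed.

HB.instance Definition _ :=
  Measure_isProbability.Build _ _ _ (mixture ab P P') mixture_setT.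

Lemma ge0_integral_mixture (f : T -> \bar R) :
    (forall t, (0 <= f t)%E) -> measurable_fun setT f ->
  (\int[mixture ab P P']_t f t =
     a%:num%:E * \int[P]_t f t + b%:num%:E * \int[P']_t f t)%E.
Proof.
move=> f0 mf; rewrite /mixture ge0_integral_measure_add//.
by rewrite !ge0_integral_mscale.
Qed.
End mixture.

Section wasserstein_mixture.
Context {R : realType} {n : nat} {a b : {nonneg R}}.
Hypotheses (ab : a%:num + b%:num = 1) (a0 : 0 < a%:num) (b0 : 0 < b%:num).
Implicit Types P Q : probability 'rV[R]_n R.

Lemma P2_mixture P P' : P2 P -> P2 P' -> P2 (mixture ab P P').
Proof.
move=> hP hP'; rewrite /P2 ge0_integral_mixture.
- by apply: lte_add_pinfty; apply: lte_mul_pinfty.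
- by move=> x; rewrite lee_fin sqr_ge0.
- by apply/measurable_EFinP; exact: measurable_enorm2.
Qed.

Let cost (y : 'rV[R]_n * 'rV[R]_n) : \bar R := (enorm (y.1 - y.2) ^+ 2)%:E.

Let measurable_cost : measurable_fun setT cost.
Proof.
apply/measurable_EFinP; apply: measurable_enorm2; apply/measurable_fun_rVP => i.
rewrite (_ : (fun _ => _) = fun y : 'rV[R]_n * 'rV[R]_n => y.1 ord0 i - y.2 ord0 i).
  apply: measurable_funB.
    exact: (measurableT_comp (measurable_rV_coord i) measurable_fst).
  exact: (measurableT_comp (measurable_rV_coord i) measurable_snd).
by apply/funext => y; rewrite !mxE.
Qed.

Let cost_ge0 y : (0 <= cost y)%E. Proof. by rewrite lee_fin sqr_ge0. Qed.

Let W2sq P Q : \bar R := ereal_inf [set \int[g]_y cost y | g in coupling P Q]%E.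

Let W2sq_ge0 P Q : (0 <= W2sq P Q)%E.
Proof. by apply: le_ereal_inf_tmp => _ [g _ <-]; exact: integral_ge0. Qed.

(** Mixing two couplings gives a coupling of the mixtures, whose cost is the mixture
    of the costs. *)
Let W2sq_mixture P P' Q Q' :
  (W2sq (mixture ab P P') (mixture ab Q Q') <=
   a%:num%:E * W2sq P Q + b%:num%:E * W2sq P' Q')%E.
Proof.
have [|ioo] := eqVneq (W2sq P Q) +oo%E.
  move=> ->; rewrite gt0_muley ?lte_fin// addye ?leey//.
  by rewrite -ltNye (lt_le_trans ltNy0)// mule_ge0// lee_fin.
have [|ioo'] := eqVneq (W2sq P' Q') +oo%E.
  move=> ->; rewrite gt0_muley ?lte_fin// addey ?leey//.
  by rewrite -ltNye (lt_le_trans ltNy0)// mule_ge0// lee_fin.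
have fin1 : W2sq P Q \is a fin_num by rewrite ge0_fin_numE// ltey.
have fin2 : W2sq P' Q' \is a fin_num by rewrite ge0_fin_numE// ltey.
apply/lee_addgt0Pr => e e0.
have [_ [g gPQ <-] /ltW gle] := lb_ereal_inf_adherent e0 fin1.
have [_ [g' gPQ' <-] /ltW gle'] := lb_ereal_inf_adherent e0 fin2.
apply: (@le_trans _ _ (\int[mixture ab g g']_y cost y)%E).
  apply: ereal_inf_lbound; exists (mixture ab g g') => // A mA.
  have [g1 g2] := gPQ A mA; have [g1' g2'] := gPQ' A mA.
  split; apply: (etrans (mixtureE ab g g' _)).
    by rewrite g1 g1'; apply/esym; exact: mixtureE.
  by rewrite g2 g2'; apply/esym; exact: mixtureE.
rewrite ge0_integral_mixture//.
apply: (@le_trans _ _ (a%:num%:E * (W2sq P Q + e%:E) +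
    b%:num%:E * (W2sq P' Q' + e%:E))%E).
  by apply: leeD; rewrite lee_wpmul2l ?lee_fin.
rewrite !ge0_muleDr ?lee_fin ?(ltW e0)// addeACA leeD2l//.
by rewrite -!EFinM -EFinD lee_fin -mulrDl ab mul1r.
Qed.

Lemma W2_ge0 P Q : (0 <= W2 P Q)%E.
Proof. exact: poweR_ge0. Qed.

(** The weights are at most [1] and the square root is subadditive. The loss of the
    weights is harmless, as only absolute continuity is to be transferred. *)
Lemma W2_mixture P P' Q Q' :
  (W2 (mixture ab P P') (mixture ab Q Q') <= W2 P Q + W2 P' Q')%E.
Proof.
have -> : W2 (mixture ab P P') (mixture ab Q Q') =
    sqrte (W2sq (mixture ab P P') (mixture ab Q Q')).
  by rewrite -poweR12_sqrt.
have -> : W2 P Q = sqrte (W2sq P Q) by rewrite -poweR12_sqrt.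
have -> : W2 P' Q' = sqrte (W2sq P' Q') by rewrite -poweR12_sqrt.
have i0 := W2sq_ge0 P Q; have i0' := W2sq_ge0 P' Q'.
apply: (@le_trans _ _ (sqrte (a%:num%:E * W2sq P Q + b%:num%:E * W2sq P' Q'))).
  rewrite lee_sqrt ?W2sq_mixture//.
  by rewrite adde_ge0// mule_ge0// lee_fin.
move: i0 i0'; case: (W2sq P Q) => [x||]; case: (W2sq P' Q') => [y||]//=; rewrite ?leey//.
rewrite !lee_fin => x0 y0.
rewrite -(@ler_pXn2r _ 2) ?nnegrE ?sqrtr_ge0 ?addr_ge0 ?sqrtr_ge0//.
rewrite sqrrD !sqr_sqrtr ?addr_ge0 ?mulr_ge0//.
have sxy := mulr_ge0 (sqrtr_ge0 x) (sqrtr_ge0 y).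
have a1 : a%:num <= 1 by rewrite -ab lerDl.
have b1 : b%:num <= 1 by rewrite -ab lerDr.
nra.
Qed.

Lemma metric_velocity_mixture (mu mu' : R -> probability 'rV[R]_n R) t :
  (metric_velocity (fun s => mixture ab (mu s) (mu' s)) t <=
   metric_velocity mu t + metric_velocity mu' t)%E.
Proof.
have mv0 (nu : R -> probability 'rV[R]_n R) : (0 <= metric_velocity nu t)%E.
  apply: limf_esup_ge0; first exact: filter_not_empty.
  by move=> s; rewrite mule_ge0 ?W2_ge0// lee_fin invr_ge0.
apply: le_trans; last first.
  apply: lime_supD; apply: ge0_adde_def; rewrite inE; exact: mv0.
apply: lime_sup_le; near=> r => s _ _ /=.
rewrite -ge0_muleDl ?W2_ge0//.
by rewrite lee_wpmul2r ?lee_fin ?invr_ge0 ?W2_mixture.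
Unshelve. all: by end_near. Qed.

Lemma AC2_mixture (mu mu' : R -> probability 'rV[R]_n R) :
  AC2 mu -> AC2 mu' -> AC2 (fun t => mixture ab (mu t) (mu' t)).
Proof.
move=> [P2mu [g Lg gle] [w Lw wle]] [P2mu' [g' Lg' gle'] [w' Lw' wle']].
split.
- by move=> t t01; apply: P2_mixture; [exact: P2mu|exact: P2mu'].
- exists (g \+ g'); first exact: Lp_onD.
  move=> s t s0 st t1.
  have ig (h : R -> R) : Lp_on lebesgue_measure `]0%R, 1%R[ 1 h ->
      lebesgue_measure.-integrable `]s, t[ (EFin \o h).
    move=> Lh; have : lebesgue_measure.-integrable `]0%R, 1%R[ (EFin \o h).
      apply: (le_integrable _ _ _ (Lp_on_integrable Lh)) => //.
        by apply/measurable_EFinP; exact: Lh.1.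
      by move=> r _ /=; rewrite powRr1// normr_id.
    apply: integrableS => //; by apply: subset_itv; rewrite bnd_simp.
  apply: (le_trans (W2_mixture _ _ _ _)).
  have gD : (\int[lebesgue_measure]_(r in `]s, t[) ((g \+ g') r)%:E =
      \int[lebesgue_measure]_(r in `]s, t[) (g r)%:E +
      \int[lebesgue_measure]_(r in `]s, t[) (g' r)%:E)%E.
    have mst : measurable (`]s, t[ : set (measurableTypeR R)) by exact: measurable_itv.
    exact: (integralD mst (ig _ Lg) (ig _ Lg')).
  by rewrite gD; apply: leeD; [exact: gle|exact: gle'].
- exists (w \+ w'); first exact: Lp_onD.
  have aeF := ae_filter_ringOfSetsType (@lebesgue_measure R).
  move: wle wle'; apply: (@filterS2 _ _ aeF) => t wt wt' t01; rewrite EFinD.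
  apply: (le_trans (metric_velocity_mixture _ _ _)).
  by apply: leeD; [exact: wt|exact: wt'].
Qed.

End wasserstein_mixture.

(** * Borel measurability and test functions on space-time *)

Section row_vectors.
Context {R : realType} {n : nat}.
Local Notation TX := (measurableTypeR R * 'rV[R]_n)%type.

Lemma measurable_fun_rV_on {d} {T : measurableType d} {D : set T} {f : T -> 'rV[R]_n} :
  measurable D -> (forall i, measurable_fun D (fun t => f t ord0 i)) ->
  measurable_fun D f.
Proof.
move=> mD mf; pose g t : 'rV[R]_n := \row_i (((fun s => f s ord0 i) \_ D) t).
apply: (@eq_measurable_fun _ _ _ _ _ g).
  by move=> t Dt; apply/rowP => i; rewrite mxE patchE Dt.
apply: measurable_funTS; apply/measurable_fun_rVP => i.
rewrite (_ : (fun _ => _) = (fun s => f s ord0 i) \_ D).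
  by apply/(measurable_restrictT _ mD); exact: mf.
by apply/funext => t; rewrite mxE.
Qed.

Lemma continuous_measurable_rV (g : 'rV[R]_n -> R) :
  continuous g -> measurable_fun setT g.
Proof.
move=> cg mT; apply: (measurability _ (RGenOpens.measurableE R)) => //.
move=> _ [_ [x [y ->]] <-]; rewrite setTI measurable_rVE.
apply: sub_sigma_algebra => /=; apply: open_comp; last exact: interval_open.
by move=> z _; exact: cg.
Qed.

End row_vectors.

Section spacetime_continuous.
Context {R : realType} {n : nat}.
Local Notation TX := (measurableTypeR R * 'rV[R]_n)%type.

Let split_rV (x : 'rV[R]_n.+1) : R * 'rV[R]_n :=
  (x ord0 ord0, \row_i x ord0 (lift ord0 i)).

Let split_rVK z : split_rV (cons_rV z) = z.
Proof.
case: z => t x; congr pair.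
  have -> : ord0 = lshift n (ord0 : 'I_1) :> 'I_(1 + n) by exact: val_inj.
  by rewrite [LHS](@row_mxEl _ 1 1 n) mxE eqxx mulr1n.
apply/rowP => i; rewrite mxE.
have -> : lift ord0 i = rshift 1 i :> 'I_(1 + n) by exact: val_inj.
by rewrite [LHS](@row_mxEr _ 1 1 n).
Qed.

Let split_rV_continuous : continuous split_rV.
Proof.
move=> x A /nbhs_ballP[e e0 eA]; apply/nbhs_ballP; exists e => // y [_ xy].
apply: eA; split; first exact: xy.
by split=> // i j; rewrite !mxE; exact: xy.
Qed.

(** Space-time is a measurable and homeomorphic copy of ['rV_n.+1], whose measurable
    sets are the Borel sets. *)
Lemma continuous_measurable_tx (g : R * 'rV[R]_n -> R) :
  continuous g -> @measurable_fun _ _ TX R setT g.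
Proof.
move=> cg; have -> : g = (g \o split_rV) \o (@cons_rV R n).
  by apply/funext => z /=; rewrite split_rVK.
apply: (measurableT_comp _ (@measurable_cons_rV R n)).
apply: continuous_measurable_rV => x.
by apply: continuous_comp; [exact: split_rV_continuous|exact: cg].
Qed.

(** Off its compact support the test function vanishes near each point, so the
    derivative is bounded by its maximum over the support. *)
Lemma test_function_derive (phi : R * 'rV[R]_n -> R) u : test_function phi ->
  @measurable_fun _ _ TX R setT ('D_u phi) /\
  exists2 M, 0 <= M & forall z, `|'D_u phi z| <= M.
Proof.
move=> [smooth [K [cK _ phi0]]].
have cD : continuous ('D_u phi) by exact: (smooth 1).2.
split; first exact: continuous_measurable_tx.
have /compact_bounded[M [_ MD]] : compact ('D_u phi @` K).
  by apply: continuous_compact => //; exact: continuous_subspaceT.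
exists (`|M| + 1) => [|z]; first by rewrite addr_ge0.
have [Kz|nKz] := pselect (K z).
  by apply: (MD (`|M| + 1)); [rewrite (le_lt_trans (ler_norm M))// ltrDl|exists z].
have -> : 'D_u phi z = 'D_u (cst 0) z.
  apply: near_eq_derive.
  have oK : open (~` K) by apply: closed_openC; exact: compact_closed cK.
  by have : nbhs z (~` K); [exact: open_nbhs_nbhs|apply: filterS => y /phi0].
by rewrite derive_cst normr0 addr_ge0.
Qed.

End spacetime_continuous.

(** * Interpolating densities and fluxes *)

Section interpolation.
Context {R : realType} {n : nat}.
Local Notation TX := (measurableTypeR R * 'rV[R]_n)%type.
Let lam : {measure set TX -> \bar R} := @lebesgue_tx R n.
Let mQ : measurable (@Q R n : set TX) := measurable_Q.

(** The part of [CE2] that does not involve the dynamics; the costs are finite and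
    the tangent inequalities hold for all such pairs. *)
Record admissible (p : R) (m : R * 'rV[R]_n -> R)
    (v : R * 'rV[R]_n -> 'rV[R]_n) : Prop := {
  adm_ge0 : forall z, Q z -> 0 <= m z ;
  adm_mass : (\int[lam]_(z in Q) (m z)%:E = 1)%E ;
  adm_kappa : lam.-integrable Q (fun z => (kappa z.2 * m z)%:E) ;
  adm_Lp : Lp_on lam Q p m ;
  adm_mv : @measurable_fun _ _ TX _ Q v ;
  adm_energy : lam.-integrable Q (fun z => (enorm (v z) ^+ 2 * m z)%:E) }.

Lemma CE2_admissible {p mu0 mu1 m v} : CE2 p mu0 mu1 m v -> admissible p m v.
Proof.
move=> [[m0 m1 mk mp] [mv iv] _ _]; have mv' : @measurable_fun _ _ TX _ Q v by exact: mv.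
split=> //; apply/integrableP; split.
  apply/measurable_EFinP; apply: measurable_funM; last exact: mp.1.
  exact: measurable_enorm2.
apply: le_lt_trans iv; rewrite le_eqVlt; apply/orP; left; apply/eqP.
apply: eq_integral => z; rewrite inE => Qz.
by rewrite gee0_abs// lee_fin mulr_ge0 ?sqr_ge0 ?m0.
Qed.

Lemma adm_meas {p m v} : admissible p m v -> @measurable_fun _ _ TX R Q m.
Proof. by move=> h; exact: (adm_Lp _ _ _ h).1. Qed.

Lemma adm_integrable {p m v} : admissible p m v -> lam.-integrable Q (EFin \o m).
Proof.
move=> h; have mm := adm_meas h; apply: (le_integrable mQ) (adm_kappa _ _ _ h).
  exact/measurable_EFinP.
move=> z Qz /=; rewrite lee_fin normrM ler_peMl// /kappa ger0_norm ?lerDl ?sqr_ge0//.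
by rewrite addr_ge0// sqr_ge0.
Qed.

Definition ce_integrand (phi : R * 'rV[R]_n -> R) m
    (v : R * 'rV[R]_n -> 'rV[R]_n) z : R :=
  m z * ('D_(1, 0) phi z + \sum_(i < n) v z ord0 i * 'D_(0, delta_mx ord0 i) phi z).

(** The weak continuity equation can be added term by term because its integrand is
    integrable: the derivatives of [phi] are bounded, and a momentum is bounded by
    the mass plus the kinetic energy. *)
Lemma integrable_ce_integrand {p m v phi} : admissible p m v -> test_function phi ->
  lam.-integrable Q (fun z => (ce_integrand phi m v z)%:E).
Proof.
move=> h tphi; have mm := adm_meas h; have mv := adm_mv _ _ _ h.
have /choice[M HM] u : exists M, 0 <= M /\ forall z, `|'D_u phi z| <= M.
  by have [_ [M M0 HM]] := test_function_derive phi u tphi; exists M.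
pose C := M (1, 0) + \sum_(i < n) M (0, delta_mx ord0 i).
have mE : @measurable_fun _ _ TX _ Q (fun z => (ce_integrand phi m v z)%:E).
  apply/measurable_EFinP; apply: measurable_funM => //; apply: measurable_funD.
    by apply: measurable_funTS; have [] := test_function_derive phi (1, 0) tphi.
  apply: measurable_sum => i; apply: measurable_funM.
    exact: (measurableT_comp (measurable_rV_coord i) mv).
  apply: measurable_funTS.
  by have [] := test_function_derive phi (0, delta_mx ord0 i) tphi.
apply: (le_integrable mQ mE); last first.
  exact: (integrableZl mQ C (integrableD mQ (adm_integrable h) (adm_energy _ _ _ h))).
move=> z Qz; have mz := adm_ge0 _ _ _ h z Qz.
rewrite /= lee_fin; apply: le_trans (ler_norm _).
rewrite /ce_integrand normrM (ger0_norm mz) mulrC.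
rewrite (_ : C * _ = C * (1 + enorm (v z) ^+ 2) * m z); last by ring.
apply: ler_wpM2r => //.
rewrite /C mulrDl; apply: (le_trans (ler_normD _ _)); apply: lerD.
  have [M0 HMz] := HM (1, 0); apply: (le_trans (HMz z)).
  by rewrite ler_peMr// lerDl sqr_ge0.
apply: (le_trans (ler_norm_sum _ _ _)); rewrite mulr_suml; apply: ler_sum => i _.
have [M0 HMz] := HM (0, delta_mx ord0 i).
rewrite normrM mulrC; apply: ler_pM => //.
have := sqr_coord_le (v z) i; rewrite -[_ ^+ 2]real_normK ?num_real//.
have := normr_ge0 (v z ord0 i); nra.
Qed.

Definition interp_density (a b : R) (m m' : R * 'rV[R]_n -> R) z := a * m z + b * m' z.

(** Fluxes, not velocities, interpolate linearly. Where the density vanishes so do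
    both fluxes, and the value [0] of the inverse of [0] is harmless. *)
Definition interp_velocity (a b : R) m (v : R * 'rV[R]_n -> 'rV[R]_n) m' v' z :
    'rV[R]_n :=
  (interp_density a b m m' z)^-1 *: ((a * m z) *: v z + (b * m' z) *: v' z).

Variables (a b : R) (a0 : 0 < a) (b0 : 0 < b) (ab : a + b = 1).

Lemma interp_flux m v m' v' z : 0 <= m z -> 0 <= m' z ->
  interp_density a b m m' z *: interp_velocity a b m v m' v' z =
  (a * m z) *: v z + (b * m' z) *: v' z.
Proof.
move=> mz m'z; rewrite /interp_velocity scalerA.
have [ms0|msn0] := eqVneq (interp_density a b m m' z) 0; last by rewrite divff// scale1r.
rewrite ms0 mul0r scale0r; move: ms0 => /eqP.
have am0 := mulr_ge0 (ltW a0) mz; have bm0 := mulr_ge0 (ltW b0) m'z.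
by rewrite /interp_density paddr_eq0// => /andP[/eqP-> /eqP->]; rewrite !scale0r addr0.
Qed.

(** The interpolated velocity is the average of the velocities with weights [a * m / s]
    and [b * m' / s], where [s] is the interpolated density. *)
Lemma interp_energy m v m' v' z : 0 <= m z -> 0 <= m' z ->
  enorm (interp_velocity a b m v m' v' z) ^+ 2 * interp_density a b m m' z <=
  a * (enorm (v z) ^+ 2 * m z) + b * (enorm (v' z) ^+ 2 * m' z).
Proof.
move=> mz m'z.
have am0 := mulr_ge0 (ltW a0) mz; have bm0 := mulr_ge0 (ltW b0) m'z.
rewrite [a * _]mulrCA [b * _]mulrCA.
have := addr_ge0 am0 bm0; rewrite -/(interp_density a b m m' z) le_eqVlt.
set s := interp_density _ _ _ _ _ => /predU1P[<-|s0].
  by rewrite mulr0 addr_ge0// mulr_ge0 ?sqr_ge0.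
rewrite -ler_pdivlMr// mulrDl.
have -> : interp_velocity a b m v m' v' z = (a * m z / s) *: v z + (b * m' z / s) *: v' z.
  by rewrite /interp_velocity scalerDr !scalerA -/s ![s^-1 * _]mulrC.
have s1 : a * m z / s + b * m' z / s = 1 by rewrite -mulrDl divff ?gt_eqF.
apply: (le_trans (enorm_conv _ _ _ _ _ _ s1)); rewrite ?divr_ge0 ?(ltW s0)//.
by rewrite -2![enorm _ ^+ 2 * _ / _]mulrA ![enorm _ ^+ 2 * (_ / _)]mulrC.
Qed.

Lemma admissible_interp {p m v m' v'} : 1 < p ->
  admissible p m v -> admissible p m' v' ->
  admissible p (interp_density a b m m') (interp_velocity a b m v m' v').
Proof.
move=> p1 h h'.
have m0 := adm_ge0 _ _ _ h; have m0' := adm_ge0 _ _ _ h'.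
have mm := adm_meas h; have mm' := adm_meas h'.
have p0 : 0 <= p by lra.
have s0 z : Q z -> 0 <= interp_density a b m m' z.
  by move=> Qz; rewrite addr_ge0// mulr_ge0 ?(ltW a0) ?(ltW b0) ?m0 ?m0'.
have ms : @measurable_fun _ _ TX _ Q (interp_density a b m m').
  by apply: measurable_funD; apply: measurable_funM.
have mw : @measurable_fun _ _ TX _ Q (interp_velocity a b m v m' v').
  apply: (measurable_fun_rV_on mQ) => i.
  apply: (@eq_measurable_fun _ _ _ _ _ (fun z => (interp_density a b m m' z) `^ (- 1) *
      (a * m z * v z ord0 i + b * m' z * v' z ord0 i))).
    by move=> z; rewrite inE => Qz; rewrite powR_inv1 ?s0// !mxE.
  apply: measurable_funM; first exact: (measurableT_comp (measurable_powR _) ms).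
  apply: measurable_funD; apply: measurable_funM; try exact: measurable_funM.
    exact: (measurableT_comp (measurable_rV_coord i) (adm_mv _ _ _ h)).
  exact: (measurableT_comp (measurable_rV_coord i) (adm_mv _ _ _ h')).
split=> //.
- rewrite /interp_density.
  have -> : (\int[lam]_(z in Q) (a * m z + b * m' z)%:E =
      a%:E * \int[lam]_(z in Q) (m z)%:E + b%:E * \int[lam]_(z in Q) (m' z)%:E)%E.
    rewrite -!integralZl//; [|exact: (adm_integrable h')|exact: (adm_integrable h)].
    have iam := integrableZl mQ a (adm_integrable h).
    have ibm := integrableZl mQ b (adm_integrable h').
    by rewrite -integralD.
  by rewrite (adm_mass _ _ _ h) (adm_mass _ _ _ h') !mule1 -EFinD ab.
- have := integrableD mQ (integrableZl mQ a (adm_kappa _ _ _ h))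
    (integrableZl mQ b (adm_kappa _ _ _ h')).
  apply: eq_integrable => // z _ /=.
  by congr EFin; rewrite /interp_density; ring.
- exact: (Lp_onD mQ p0 (Lp_onZ a mQ p0 (adm_Lp _ _ _ h))
    (Lp_onZ b mQ p0 (adm_Lp _ _ _ h'))).
- have := integrableD mQ (integrableZl mQ a (adm_energy _ _ _ h))
    (integrableZl mQ b (adm_energy _ _ _ h')).
  apply: le_integrable => //.
    by apply/measurable_EFinP; apply: measurable_funM => //; exact: measurable_enorm2.
  move=> z Qz /=; rewrite lee_fin [leLHS]ger0_norm ?(mulr_ge0 (sqr_ge0 _) (s0 _ Qz))//.
  by apply: le_trans (ler_norm _); apply: interp_energy; [exact: m0|exact: m0'].
Qed.

End interpolation.

(** * Stability of the competitors under interpolation *)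

Section ce_interpolation.
Context {R : realType} {n : nat}.
Local Notation TX := (measurableTypeR R * 'rV[R]_n)%type.
Let lam : {measure set TX -> \bar R} := @lebesgue_tx R n.
Let mQ : measurable (@Q R n : set TX) := measurable_Q.

Definition disintegrates (m : R * 'rV[R]_n -> R) (mu : R -> probability 'rV[R]_n R) :=
  forall A : set TX, measurable A ->
    (\int[lam]_(z in Q `&` A) (m z)%:E =
     \int[lebesgue_measure]_(t in `]0%R, 1%R[) mu t (xsection A t))%E.

Let unit_itv : (\int[lebesgue_measure]_(t in `]0%R, 1%R[) (cst 1 t) = 1 :> \bar R)%E.
Proof.
rewrite integral_cst//= mul1e.
by have -> : lebesgue_measure (`]0, 1[ : set R) = 1%E
  by rewrite lebesgue_measure_itv/= lte01 oppr0 addr0.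
Qed.

(** The sections of [A] are not known to have measurable mass in [t]. One inequality
    is superadditivity of the integral; the same inequality for the complement of [A]
    turns it into an equality because the masses of both sides add up to [1]. *)
Lemma disintegrates_mixture {p m v m' v' mu mu'} {a b : {nonneg R}}
    (ab : a%:num + b%:num = 1) :
    admissible p m v -> admissible p m' v' ->
    disintegrates m mu -> disintegrates m' mu' ->
  disintegrates (interp_density a%:num b%:num m m') (fun t => mixture ab (mu t) (mu' t)).
Proof.
move=> h h' dm dm'.
have QI (A : set TX) : measurable A -> @measurable _ TX (Q `&` A).
  by move=> mA; exact: measurableI.
pose lhs (A : set TX) :=
  (\int[lam]_(z in Q `&` A) (interp_density a%:num b%:num m m' z)%:E)%E.
pose rhs (A : set TX) :=
  (\int[lebesgue_measure]_(t in `]0%R, 1%R[) mixture ab (mu t) (mu' t) (xsection A t))%E.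
have mass_fin k w (hk : admissible p k w) (A : set TX) : measurable A ->
    (\int[lam]_(z in Q `&` A) (k z)%:E)%E \is a fin_num.
  move=> mA; apply: integrable_fin_num; first exact: QI.
  by apply: integrableS (adm_integrable hk) => //; exact: QI.
have lhsE (A : set TX) : measurable A -> lhs A =
    (a%:num%:E * \int[lam]_(z in Q `&` A) (m z)%:E +
     b%:num%:E * \int[lam]_(z in Q `&` A) (m' z)%:E)%E.
  move=> mA; have mQA := QI A mA.
  have iA k w (hk : admissible p k w) : lam.-integrable (Q `&` A) (EFin \o k).
    by apply: integrableS (adm_integrable hk) => //; exact: subIsetl.
  rewrite -(integralZl mQA (iA _ _ h)) -(integralZl mQA (iA _ _ h')).
  have iam := integrableZl mQA a%:num (iA _ _ h).
  have ibm := integrableZl mQA b%:num (iA _ _ h').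
  by rewrite -integralD.
have lhs_fin (A : set TX) : measurable A -> lhs A \is a fin_num.
  move=> mA; rewrite lhsE//.
  by rewrite fin_numD !fin_numM// ?(mass_fin _ _ h) ?(mass_fin _ _ h').
have lhs_le (A : set TX) : measurable A -> (lhs A <= rhs A)%E.
  move=> mA; rewrite lhsE// dm// dm'//.
  have := @ge0_integral_superadd _ _ R lebesgue_measure `]0, 1[
    (fun t => mu t (xsection A t)) (fun t => mu' t (xsection A t)) a%:num b%:num.
  rewrite -dm// -dm'// (mass_fin _ _ h)// (mass_fin _ _ h')//.
  move=> /(_ _ _ _ _ erefl erefl)H; apply: (le_trans (H _ _ _ _)) => //.
  rewrite le_eqVlt; apply/orP; left; apply/eqP; apply: eq_integral => t _.
  by apply/esym; exact: mixtureE.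
have rhs_fin (A : set TX) : measurable A -> rhs A \is a fin_num.
  move=> mA; rewrite ge0_fin_numE; last exact: integral_ge0.
  apply: (@le_lt_trans _ _ 1%E); last exact: ltry.
  rewrite -[leRHS]unit_itv; apply: ge0_le_integral_nonmeasurable => // t _.
  exact: probability_le1 (measurable_xsection _ mA).
move=> A mA; have mAC := measurableC mA.
apply: le_anti; rewrite lhs_le//=.
have lhs1 : (lhs A + lhs (~` A) = 1)%E.
  have split_mass k w (hk : admissible p k w) :
      (\int[lam]_(z in Q `&` A) (k z)%:E + \int[lam]_(z in Q `&` ~` A) (k z)%:E = 1)%E.
    rewrite -(adm_mass _ _ _ hk) -[in RHS](setIT Q) -(setUv A) setIUr ge0_integral_setU//.
    - exact: QI.
    - exact: QI.
    - apply/measurable_EFinP; apply: measurable_funS (adm_meas hk) => //.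
      by rewrite -setIUr; exact: subIsetl.
    - by rewrite -setIUr => z [Qz _]; rewrite lee_fin (adm_ge0 _ _ _ hk).
    - by apply/disj_setPS => z [[_ Az] [_ nAz]].
  have mass_ge0 k w (hk : admissible p k w) B : (0 <= \int[lam]_(z in Q `&` B) (k z)%:E)%E.
    by apply: integral_ge0 => z [Qz _]; rewrite lee_fin (adm_ge0 _ _ _ hk).
  rewrite !lhsE// addeACA -!ge0_muleDr ?(mass_ge0 _ _ h) ?(mass_ge0 _ _ h')//.
  by rewrite (split_mass _ _ h) (split_mass _ _ h') !mule1 -EFinD ab.
have rhs1 : (rhs A + rhs (~` A) <= 1)%E.
  have := @ge0_integral_superadd _ _ R lebesgue_measure `]0, 1[
    (fun t => mixture ab (mu t) (mu' t) (xsection A t))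
    (fun t => mixture ab (mu t) (mu' t) (xsection (~` A) t)) 1 1 ler01 ler01.
  rewrite !mul1e => H; apply: (le_trans (H _ _ _ _)) => //.
  - exact: rhs_fin.
  - exact: rhs_fin.
  rewrite -[leRHS]unit_itv; apply: ge0_le_integral_nonmeasurable => [t _|t _].
    by rewrite !mul1e adde_ge0.
  have xC : xsection (~` A) t = ~` xsection A t.
    by apply/seteqP; split=> y; rewrite /xsection/= in_setC => /negP.
  rewrite !mul1e xC probability_setC; last exact: measurable_xsection.
  by rewrite addeC subeK// fin_num_measure//; exact: measurable_xsection.
rewrite -(leeD2rE _ _ (rhs_fin _ mAC)).
apply: (le_trans rhs1); rewrite -lhs1 leeD2l//; exact: lhs_le.
Qed.

(** The continuity equation is linear in the density and the flux, the energy is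
    convex, and mixtures of the two curves represent the interpolated density and
    keep the common endpoints. *)
Lemma CE2_interp {p : R} {mu0 mu1 : probability 'rV[R]_n R}
    {m : R * 'rV[R]_n -> R} {v : R * 'rV[R]_n -> 'rV[R]_n}
    {m' : R * 'rV[R]_n -> R} {v' : R * 'rV[R]_n -> 'rV[R]_n} {a b : R} :
    1 < p -> 0 < a -> 0 < b -> a + b = 1 ->
    CE2 p mu0 mu1 m v -> CE2 p mu0 mu1 m' v' ->
  CE2 p mu0 mu1 (interp_density a b m m') (interp_velocity a b m v m' v').
Proof.
move=> p1 a0 b0 ab hm hm'.
have h := CE2_admissible hm; have h' := CE2_admissible hm'.
have hs := admissible_interp a b a0 b0 ab p1 h h'.
case: hm => _ _ ce [mu [mu_ac mu_dis mu_0 mu_1]].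
case: hm' => _ _ ce' [mu' [mu_ac' mu_dis' mu_0' mu_1']].
split.
- split; [exact: (adm_ge0 _ _ _ hs)|exact: (adm_mass _ _ _ hs)|
    exact: (adm_kappa _ _ _ hs)|exact: (adm_Lp _ _ _ hs)].
- split; first exact: (adm_mv _ _ _ hs).
  have /integrableP[_] := adm_energy _ _ _ hs; apply: le_lt_trans.
  rewrite le_eqVlt; apply/orP; left; apply/eqP; apply: eq_integral => z.
  by rewrite inE => Qz; rewrite gee0_abs// lee_fin mulr_ge0 ?sqr_ge0 ?(adm_ge0 _ _ _ hs).
- move=> phi tphi.
  have i1 := integrable_ce_integrand h tphi; have i2 := integrable_ce_integrand h' tphi.
  transitivity (\int[lam]_(z in Q) (a%:E * (ce_integrand phi m v z)%:E +
      b%:E * (ce_integrand phi m' v' z)%:E))%E.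
    apply: eq_integral => z; rewrite inE => Qz; rewrite -!EFinM -EFinD; congr EFin.
    have mz := adm_ge0 _ _ _ h z Qz; have mz' := adm_ge0 _ _ _ h' z Qz.
    have flux := interp_flux a b a0 b0 m v m' v' z mz mz'.
    rewrite /ce_integrand !mulrDr !mulrA addrACA -mulrDl; congr (_ + _).
    rewrite !mulr_sumr -big_split/=; apply: eq_bigr => i _.
    rewrite !mulrA -mulrDl; congr (_ * _).
    by have /rowP/(_ i) := flux; rewrite !mxE.
  rewrite integralD//; [|exact: (integrableZl mQ)|exact: (integrableZl mQ)].
  by rewrite !integralZl// (ce _ tphi) (ce' _ tphi) !mule0 adde0.
- pose a' := NngNum (ltW a0); pose b' := NngNum (ltW b0).
  have ab' : a'%:num + b'%:num = 1 by [].
  exists (fun t => mixture ab' (mu t) (mu' t)); split.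
  + exact: AC2_mixture.
  + exact: (disintegrates_mixture ab' h h' mu_dis mu_dis').
  + move=> A mA; apply: (etrans (mixtureE ab' _ _ _)).
    by rewrite mu_0// mu_0'// -ge0_muleDl// -EFinD ab' mul1e.
  + move=> A mA; apply: (etrans (mixtureE ab' _ _ _)).
    by rewrite mu_1// mu_1'// -ge0_muleDl// -EFinD ab' mul1e.
Qed.

End ce_interpolation.

(** * First-order optimality *)

Section optimality.
Context {R : realType} {n : nat} {p q : R}.
Hypotheses (hp : 1 < p) (hq : 1 < q) (hpq : p^-1 + q^-1 = 1).
Context {H : 'rV[R]_n -> 'rV[R]_n -> R} {f : 'rV[R]_n -> R -> R}.
Hypotheses (hH : H_assumptions H) (hf : f_assumptions p q f).
Local Notation TX := (measurableTypeR R * 'rV[R]_n)%type.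
Let lam : {measure set TX -> \bar R} := @lebesgue_tx R n.
Let mQ : measurable (@Q R n : set TX) := measurable_Q.
Implicit Types (m u : R * 'rV[R]_n -> R) (v : R * 'rV[R]_n -> 'rV[R]_n).

(** Both functionals are the common kinetic energy plus a remainder: the potential
    for one, and for the other the integral of the density against the
    congestion [f x (u t x)], with [u] the reference density. *)
Definition kinetic m v : \bar R := (\int[lam]_(z in Q) (Lagr H z.2 (v z) * (m z)%:E))%E.
Definition potential m : \bar R := (\int[lam]_(z in Q) (Fprim f z.2 (m z))%:E)%E.
Definition congestion u m : \bar R := (\int[lam]_(z in Q) (f z.2 (u z) * m z)%:E)%E.

Let iK {m v} (h : admissible p m v) :
  lam.-integrable Q (fun z => Lagr H z.2 (v z) * (m z)%:E)%E.
Proof.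
exact: (integrable_Lagr hH (adm_ge0 _ _ _ h) (adm_meas h) (adm_kappa _ _ _ h)
  (adm_mv _ _ _ h) (adm_energy _ _ _ h)).
Qed.

Let iG {m v} (h : admissible p m v) : lam.-integrable Q (fun z => (Fprim f z.2 (m z))%:E).
Proof. exact: (integrable_Fprim hp hq hpq hf (adm_ge0 _ _ _ h) (adm_Lp _ _ _ h)). Qed.

Let iA {u v m v'} (h : admissible p u v) (h' : admissible p m v') :
  lam.-integrable Q (fun z => (f z.2 (u z) * m z)%:E).
Proof.
exact: (integrable_congestion hp hq hpq hf (adm_ge0 _ _ _ h) (adm_ge0 _ _ _ h')
  (adm_Lp _ _ _ h) (adm_Lp _ _ _ h')).
Qed.

Lemma BcostE {m v} : admissible p m v -> Bcost H f m v = (kinetic m v + potential m)%E.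
Proof. by move=> h; rewrite -integralD//; [exact: (iK h)|exact: (iG h)]. Qed.

Lemma LcostE {u v0 m v} : admissible p u v0 -> admissible p m v ->
  Lcost H (fun z => f z.2 (u z)) m v = (kinetic m v + congestion u m)%E.
Proof.
move=> hu h; rewrite -integralD//; [|exact: (iK h)|exact: (iA hu h)].
apply: eq_integral => z _; rewrite EFinM muleDl//.
by rewrite fin_num_adde_defl.
Qed.

(** The potential lies above its tangents, by convexity of the primitive. *)
Lemma potential_tangent {m v m' v'} : admissible p m v -> admissible p m' v' ->
  (potential m + congestion m m' <= potential m' + congestion m m)%E.
Proof.
move=> h h'.
have tangentE : (potential m + congestion m m' =
    \int[lam]_(z in Q) ((Fprim f z.2 (m z))%:E + (f z.2 (m z) * m' z)%:E))%E.
  by apply/esym; exact: (integralD mQ (iG h) (iA h h')).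
have tangentE' : (potential m' + congestion m m =
    \int[lam]_(z in Q) ((Fprim f z.2 (m' z))%:E + (f z.2 (m z) * m z)%:E))%E.
  by apply/esym; exact: (integralD mQ (iG h') (iA h h)).
rewrite [leLHS]tangentE [leRHS]tangentE'.
apply: le_integral => //.
- exact: (integrableD mQ (iG h) (iA h h')).
- exact: (integrableD mQ (iG h') (iA h h)).
move=> z; rewrite inE => Qz; rewrite -!EFinD lee_fin.
have := Fprim_convex hf z.2 (m z) (m' z) (adm_ge0 _ _ _ h z Qz) (adm_ge0 _ _ _ h' z Qz).
lra.
Qed.

Lemma kinetic_interp {a b : R} {m v m' v'} : 0 < a -> 0 < b -> a + b = 1 ->
    admissible p m v -> admissible p m' v' ->
  (kinetic (interp_density a b m m') (interp_velocity a b m v m' v') <=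
   a%:E * kinetic m v + b%:E * kinetic m' v')%E.
Proof.
move=> a0 b0 ab h h'; have hs := admissible_interp a b a0 b0 ab hp h h'.
rewrite -!integralZl//; [|exact: (iK h')|exact: (iK h)].
have iaK := integrableZl mQ a (iK h); have ibK := integrableZl mQ b (iK h').
rewrite -integralD//; apply: le_integral => //.
- exact: (iK hs).
- exact: integrableD.
move=> z; rewrite inE => Qz.
have mz := adm_ge0 _ _ _ h z Qz; have mz' := adm_ge0 _ _ _ h' z Qz.
by apply: (Lagr_convex a b) => //; exact: interp_flux.
Qed.


Let kinetic_fin {m v} (h : admissible p m v) : kinetic m v \is a fin_num.
Proof. exact: integrable_fin_num (iK h). Qed.

Let potential_fin {m v} (h : admissible p m v) : potential m \is a fin_num.
Proof. exact: integrable_fin_num (iG h). Qed.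

Let congestion_fin {u v m v'} (h : admissible p u v) (h' : admissible p m v') :
  congestion u m \is a fin_num.
Proof. exact: integrable_fin_num (iA h h'). Qed.

(** Minimality against the interpolation, divided by the weight [b] of the competitor.
    The tangent of the potential is taken at the interpolated density, so the difference
    quotient of the potential is bounded by an integral of [f] there. *)
Lemma first_variation {a b : R} {m v m' v'} : 0 < a -> 0 < b -> a + b = 1 ->
    admissible p m v -> admissible p m' v' ->
    (Bcost H f m v <=
     Bcost H f (interp_density a b m m') (interp_velocity a b m v m' v'))%E ->
  (kinetic m v - kinetic m' v' <=
   \int[lam]_(z in Q) (f z.2 (interp_density a b m m' z) * (m' z - m z))%:E)%E.
Proof.
move=> a0 b0 ab h h'; have hs := admissible_interp a b a0 b0 ab hp h h'.
rewrite (BcostE h) (BcostE hs) => Bmin.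
have Kle := kinetic_interp a0 b0 ab h h'.
set ms := interp_density a b m m' in hs Bmin Kle *.
have -> : (\int[lam]_(z in Q) (f z.2 (ms z) * (m' z - m z))%:E =
    congestion ms m' - congestion ms m)%E.
  rewrite -integralB//; [|exact: (iA hs h')|exact: (iA hs h)].
  by apply: eq_integral => z _; rewrite -EFinB mulrBr.
have Gle := potential_tangent hs h.
have msE : (congestion ms ms = a%:E * congestion ms m + b%:E * congestion ms m')%E.
  rewrite -!integralZl//; [|exact: (iA hs h')|exact: (iA hs h)].
  have iaA := integrableZl mQ a (iA hs h); have ibA := integrableZl mQ b (iA hs h').
  rewrite -integralD//.
  by apply: eq_integral => z _; rewrite -!EFinM -EFinD /ms /interp_density;
    congr EFin; ring.
have Kfin := kinetic_fin h; have Kfin' := kinetic_fin h'.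
have Ksfin := kinetic_fin hs; have Gfin := potential_fin h.
have Gsfin := potential_fin hs; have Afin := congestion_fin hs h.
have Afin' := congestion_fin hs h'.
rewrite msE in Gle; move: Bmin Kle Gle Kfin Kfin' Ksfin Gfin Gsfin Afin Afin'.
case: (kinetic m v) => [k||]//; case: (kinetic m' v') => [k'||]//.
case: (kinetic ms _) => [ks||]//; case: (potential m) => [g||]//.
case: (potential ms) => [gs||]//; case: (congestion ms m) => [c||]//.
case: (congestion ms m') => [c'||]//; rewrite !lee_fin => Bmin Kle Gle _ _ _ _ _ _ _.
have aE : a = 1 - b by lra.
rewrite aE in Kle Gle; rewrite -(ler_pM2l b0).
lra.
Qed.

(** Dominated convergence: by monotonicity in the density, [f] at the interpolations
    stays between its values at [0] and at [m + m']. *)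
Lemma congestion_cvg {m v m' v'} : admissible p m v -> admissible p m' v' ->
  (\int[lam]_(z in Q) (f z.2 (interp_density (1 - k.+2%:R^-1) k.+2%:R^-1 m m' z) *
     (m' z - m z))%:E @[k --> \oo] --> congestion m m' - congestion m m)%E.
Proof.
move=> h h'; have m0 := adm_ge0 _ _ _ h; have m0' := adm_ge0 _ _ _ h'.
have mm := adm_meas h; have mm' := adm_meas h'.
have -> : (congestion m m' - congestion m m =
    \int[lam]_(z in Q) (f z.2 (m z) * (m' z - m z))%:E)%E.
  rewrite -integralB//; [|exact: (iA h h')|exact: (iA h h)].
  by apply: eq_integral => z _; rewrite -EFinB mulrBr.
(* The common bound is (|f x 0| + |f x M|) M. *)
pose M z := m z + m' z.
have M0 z : Q z -> 0 <= M z by move=> Qz; rewrite addr_ge0 ?m0 ?m0'.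
have pge0 : 0 <= p := ltW (lt_trans ltr01 hp).
have LM : Lp_on lam Q p M := Lp_onD mQ pge0 (adm_Lp _ _ _ h) (adm_Lp _ _ _ h').
have L0 : Lp_on lam Q p (fun=> 0) := Lp_on0 (lt_trans ltr01 hp).
have i0M := integrable_congestion hp hq hpq hf (fun z _ => lexx 0) M0 L0 LM.
have iMM := integrable_congestion hp hq hpq hf M0 M0 LM LM.
have b01 k : 0 < (k.+2%:R^-1 : R) < 1 by rewrite invr_gt0 ltr0n/= invf_lt1 ?ltr1n ?ltr0n.
pose ms k := interp_density (1 - k.+2%:R^-1) k.+2%:R^-1 m m'.
have ms_bounds k z : Q z -> 0 <= ms k z <= M z.
  move=> Qz; have /andP[b0 b1] := b01 k; have mz := m0 z Qz; have mz' := m0' z Qz.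
  rewrite /ms /interp_density /M; move: (_^-1) b0 b1 => b b0 b1.
  apply/andP; split; first by rewrite addr_ge0// mulr_ge0// ?subr_ge0 ltW.
  by apply: lerD; rewrite ler_piMl//; lra.
have meas_f u : @measurable_fun _ _ TX R Q u -> (forall z, Q z -> 0 <= u z) ->
    @measurable_fun _ _ TX _ Q (fun z => (f z.2 (u z) * (m' z - m z))%:E).
  move=> mu u0; apply/measurable_EFinP; apply: measurable_funM; last exact: measurable_funB.
  apply: (@eq_measurable_fun _ _ _ _ _ (fun z : TX => extend0 f z.2 (u z))).
    by move=> z; rewrite inE => Qz; rewrite extend0E ?u0.
  by apply: (measurable_extend0 hf _ mu); apply: measurable_funTS; exact: measurable_snd.
have [] // := @dominated_convergence _ _ _ lam Q mQ
  (fun k z => (f z.2 (ms k z) * (m' z - m z))%:E)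
  (fun z => (f z.2 (m z) * (m' z - m z))%:E)
  (fun z => (`|(f z.2 0 * M z)%:E| + `|(f z.2 (M z) * M z)%:E|)%E).
- move=> k; apply: meas_f; last by move=> z /(ms_bounds k)/andP[].
  by apply: measurable_funD; apply: measurable_funM.
- exact: meas_f.
- apply: aeW => z Qz; apply: cvg_EFin; first exact: nearW.
  apply: cvgM; last exact: cvg_cst.
  rewrite -(extend0E (f := f) z.2 (m z)) ?m0//.
  have ms_cvg : ms k z @[k --> \oo] --> m z.
    have inv0 : k.+2%:R^-1 @[k --> \oo] --> (0 : R).
      by have := @cvg_harmonic R; rewrite -cvg_shiftS.
    have -> : m z = (1 - 0) * m z + 0 * m' z by ring.
    apply: cvgD; apply: cvgM; try exact: cvg_cst.
      by apply: cvgB => //; exact: cvg_cst.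
    exact: inv0.
  rewrite (_ : (fun k => _) = fun k => extend0 f z.2 (ms k z)).
    exact: (cvg_comp _ _ ms_cvg (extend0_continuous hf z.2 (m z))).
  apply/funext => k /=; have /andP[ms0 _] := ms_bounds k z Qz.
  by rewrite extend0E.
- exact: (integrableD mQ (integrable_abse i0M) (integrable_abse iMM)).
apply: aeW => z k Qz; rewrite lee_fin !normrM (ger0_norm (M0 z Qz)) -mulrDl.
have /andP[ms0 msM] := ms_bounds k z Qz.
have f1 := f_increasing hf z.2 (lexx 0) ms0.
have f2 := f_increasing hf z.2 ms0 msM.
apply: ler_pM => //.
  have n0 := ler_norm (- f z.2 0); rewrite normrN in n0.
  have nM := ler_norm (f z.2 (M z)).
  have p0 := normr_ge0 (f z.2 0); have pM := normr_ge0 (f z.2 (M z)).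
  by rewrite ler_norml; apply/andP; split; lra.
rewrite ler_norml /M; have := m0 z Qz; have := m0' z Qz.
by move=> ? ?; apply/andP; split; lra.
Qed.

Let leD_of_leB {k k' c c' : \bar R} : k \is a fin_num -> k' \is a fin_num ->
    c \is a fin_num -> c' \is a fin_num ->
  (k - k' <= c' - c -> k + c <= k' + c')%E.
Proof.
move: k k' c c' => [k||] [k'||] [c||] [c'||]// _ _ _ _.
by rewrite -!EFinB -!EFinD !lee_fin; lra.
Qed.

Let le_of_tangent {k k' g g' c c' : \bar R} :
    k \is a fin_num -> k' \is a fin_num -> g \is a fin_num -> g' \is a fin_num ->
    c \is a fin_num -> c' \is a fin_num ->
  (g + c' <= g' + c -> k + c <= k' + c' -> k + g <= k' + g')%E.
Proof.
move: k k' g g' c c' => [k||]// [k'||]// [g||]// [g'||]// [c||]// [c'||]// _ _ _ _ _ _.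
by rewrite -!EFinD !lee_fin; lra.
Qed.

(** The first variations hold for all weights [1 / (k + 2)] on the competitor, and
    [congestion_cvg] passes to the limit. *)
Lemma Bmin_Lmin {mu0 mu1 : probability 'rV[R]_n R} {m v} : CE2 p mu0 mu1 m v ->
  (forall m' v', CE2 p mu0 mu1 m' v' -> (Bcost H f m v <= Bcost H f m' v')%E) ->
  forall m' v', CE2 p mu0 mu1 m' v' ->
    (Lcost H (fun z => f z.2 (m z)) m v <= Lcost H (fun z => f z.2 (m z)) m' v')%E.
Proof.
move=> hmv Bmin m' v' hmv'.
have h := CE2_admissible hmv; have h' := CE2_admissible hmv'.
rewrite (LcostE h h) (LcostE h h').
have le_lim : (kinetic m v - kinetic m' v' <= congestion m m' - congestion m m)%E.
  have cvgD_ := congestion_cvg h h'.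
  rewrite -(cvg_lim _ cvgD_)//; apply: lime_ge.
    by apply/cvg_ex; eexists; exact: cvgD_.
  apply: nearW => k; have k0 : 0 < k.+2%:R^-1 :> R by rewrite invr_gt0 ltr0n.
  have k1 : 0 < 1 - k.+2%:R^-1 :> R by rewrite subr_gt0 invf_lt1 ?ltr1n ?ltr0n.
  have kE : 1 - k.+2%:R^-1 + k.+2%:R^-1 = 1 :> R by rewrite subrK.
  by apply: (first_variation k1 k0 kE h h'); apply: Bmin; exact: (CE2_interp hp k1 k0 kE).
exact: (leD_of_leB (kinetic_fin h) (kinetic_fin h') (congestion_fin h h)
  (congestion_fin h h') le_lim).
Qed.

(** The potential lies above its tangent at [m]: each single competitor that does not
    beat [m] in the linearised cost does not beat it in the original one. *)
Lemma Lmin_Bmin {m v m' v'} : admissible p m v -> admissible p m' v' ->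
  (Lcost H (fun z => f z.2 (m z)) m v <= Lcost H (fun z => f z.2 (m z)) m' v')%E ->
  (Bcost H f m v <= Bcost H f m' v')%E.
Proof.
move=> h h'; rewrite (LcostE h h) (LcostE h h') (BcostE h) (BcostE h').
have := potential_tangent h h'.
exact: (le_of_tangent (kinetic_fin h) (kinetic_fin h') (potential_fin h)
  (potential_fin h') (congestion_fin h h) (congestion_fin h h')).
Qed.

End optimality.

Theorem theorem6p16 (R : realType) (d : nat) (hd : (1 <= d)%N)
    (p q : R) (hp : 1 < p) (hq : 1 < q) (hpq : p^-1 + q^-1 = 1)
    (H : 'rV[R]_d -> 'rV[R]_d -> R) (hH : H_assumptions H)
    (f : 'rV[R]_d -> R -> R) (hf : f_assumptions p q f)
    (mu0 mu1 : probability 'rV[R]_d R) (hmu0 : P2r p mu0) (hmu1 : P2r p mu1)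
    (m : R * 'rV[R]_d -> R) (v : R * 'rV[R]_d -> 'rV[R]_d)
    (hmv : CE2 p mu0 mu1 m v) :
  let alpha : R * 'rV[R]_d -> R := fun z => f z.2 (m z) in
  (forall (m' : R * 'rV[R]_d -> R) (v' : R * 'rV[R]_d -> 'rV[R]_d),
     CE2 p mu0 mu1 m' v' -> (Bcost H f m v <= Bcost H f m' v')%E)
  <->
  (forall (m' : R * 'rV[R]_d -> R) (v' : R * 'rV[R]_d -> 'rV[R]_d),
     CE2 p mu0 mu1 m' v' -> (Lcost H alpha m v <= Lcost H alpha m' v')%E).
Proof.
move=> alpha; split=> [Bmin m' v' hmv'|Lmin m' v' hmv'].
  exact: (Bmin_Lmin hp hq hpq hH hf hmv Bmin).
have h := CE2_admissible hmv; have h' := CE2_admissible hmv'.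
exact: (Lmin_Bmin hp hq hpq hH hf h h' (Lmin m' v' hmv')).
Qed.
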